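(* There is an algorithm that, given a finite-state automaton $\mathcal{S}=(X,T,X_0,\to,\Sigma,\ell)$ with event set partitioned as $T=T_c\sqcup T_{uc}$ into controllable and uncontrollable events, and $k_1,k_2\in\mathbb{N}$, such that $\mathcal{S}$ is not $\omega$-$(k_1,k_2)$-detectable (resp. not $*$-$(k_1,k_2)$-detectable), decides in polynomial time (polynomial in the size of $\mathcal{S}$ and in $k_1,k_2$) whether there is a set $\mathcal{T}_c$ of controllable transitions of $\mathcal{S}$ such that $\mathcal{S}_{\setminus\mathcal{T}_c}$ is $\omega$-$(k_1,k_2)$-detectable (resp. $*$-$(k_1,k_2)$-detectable).
   Context: A finite-state automaton (FSA) is a sextuple $\mathcal{S}=(X,T,X_0,\to,\Sigma,\ell)$, where $X$ is a finite set of states, $T$ a finite set of events, $X_0\subset X$ a set of initial states, $\to\subset X\times T\times X$ a transition relation, $\Sigma$ a finite set of labels, and $\ell:T\to\Sigma\cup\{\epsilon\}$ a labeling function ($\epsilon$ is the empty word). $\ell$ is extended to finite and infinite event sequences by $\ell(t_1t_2\dots)=\ell(t_1)\ell(t_2)\dots$, $\ell(\epsilon)=\epsilon$. For $s=t_1\cdots t_n\in T^*$, $x\xrightarrow{s}x'$ means that there are states $x=x_0,x_1,\dots,x_n=x'$ with $(x_{i-1},t_i,x_i)\in\to$ for all $i$ (so $x\xrightarrow{\epsilon}x$). The size of $\mathcal{S}$ is e.g. $|X|+|T|+|\Sigma|+|\to|$. A transition $(x,t,x')\in\to$ is controllable if $t\in T_c$. For a set $\mathcal{T}_c$ of controllable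 transitions, $\mathcal{S}_{\setminus\mathcal{T}_c}$ is the FSA obtained from $\mathcal{S}$ by disabling (removing from $\to$) all transitions in $\mathcal{T}_c$. For $\sigma_1,\sigma_2\in\Sigma^*$ define the delayed state estimate $$\mathcal{M}(\mathcal{S},\sigma_1,\sigma_2)=\{x\in X\mid \exists x_0\in X_0,\ \exists x'\in X,\ \exists s_1,s_2\in T^*:\ \ell(s_1)=\sigma_1,\ \ell(s_2)=\sigma_2,\ x_0\xrightarrow{s_1}x\xrightarrow{s_2}x'\}.$$ The language $\mathcal{L}(\mathcal{S})$ is the set of $\sigma\in\Sigma^*$ such that $x_0\xrightarrow{s}x$ for some $x_0\in X_0$, $x\in X$, $s\in T^*$ with $\ell(s)=\sigma$. The $\omega$-language $\mathcal{L}^\omega(\mathcal{S})$ is the set of $\sigma\in\Sigma^\omega$ (infinite words) such that $\sigma=\ell(t_1t_2\dots)$ for some infinite event sequence $t_1t_2\dots\in T^\omega$ for which there are states $x_0,x_1,\dots$ with $x_0\in X_0$ and $(x_i,t_{i+1},x_{i+1})\in\to$ for all $i\in\mathbb{N}$. Write $\sigma'\sqsubset\sigma$ if the finite word $\sigma'$ is a prefix of $\sigma$ (possibly equal to $\sigma$ when $\sigma$ is finite). $\mathcal{S}$ is $\omega$-$(k_1,k_2)$-detectable (resp. $*$-$(k_1,k_2)$-detectable) if for all $\sigma\in\mathcal{L}^\omega(\mathcal{S})$ (resp. all $\sigma\in\mathcal{L}(\mathcal{S})$) and all $\sigma_1,\sigma_2\in\Sigma^*$ with $\sigma_1\sigma_2\sqsubset\sigma$: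 if $|\sigma_1|\ge k_1$ and $|\sigma_2|\ge k_2$, then $|\mathcal{M}(\mathcal{S},\sigma_1,\sigma_2)|=1$. *)

(* Defs.v *)
From mathcomp Require Import all_boot all_order all_algebra.
From mathcomp Require Import boolp.

Set Implicit Arguments.
Unset Strict Implicit.
Unset Printing Implicit Defensive.

(** * Finite-state automata *)

(* [label t = None] stands for the empty label epsilon. *)
Record fsa (X T Sigma : finType) := Fsa {
  initial : {set X};
  trans : {set X * T * X};
  label : T -> option Sigma
}.

Section Automata.
Variables (X T Sigma : finType).
Implicit Types (S : fsa X T Sigma) (sigma : nat -> Sigma) (tau : nat -> T).

Definition fsa_size S : nat := #|X| + #|T| + #|Sigma| + #|trans S|.

Definition label_word S (s : seq T) : seq Sigma := pmap (label S) s.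

Fixpoint run S (x : X) (s : seq T) (y : X) : bool :=
  if s is t :: s' then
    [exists z : X, ((x, t, z) \in trans S) && run S z s' y]
  else x == y.

Definition delayed_estimate S (sigma1 sigma2 : seq Sigma) : {set X} :=
  [set x | `[< exists (x0 x' : X) (s1 s2 : seq T),
      [/\ x0 \in initial S, label_word S s1 = sigma1,
          label_word S s2 = sigma2, run S x0 s1 x & run S x s2 x'] >]].

Definition language S (w : seq Sigma) : Prop :=
  exists (x0 x : X) (s : seq T),
    [/\ x0 \in initial S, run S x0 s x & label_word S s = w].

(* Infinite words are functions on [nat], so [mkseq sigma n] is the prefix of
   length [n] of [sigma]. *)
Definition omega_prefix (w : seq Sigma) sigma : Prop :=
  w = mkseq sigma (size w).

(* l(tau) = sigma: the labels of the finite prefixes of tau are prefixes of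
   sigma of unbounded length.  In particular an infinite event sequence with
   only finitely many non-epsilon labels generates no infinite word. *)
Definition omega_label S tau sigma : Prop :=
  (forall n, omega_prefix (label_word S (mkseq tau n)) sigma) /\
  (forall m, exists n, m <= size (label_word S (mkseq tau n))).

Definition omega_language S sigma : Prop :=
  exists (rho : nat -> X) (tau : nat -> T),
    [/\ rho 0 \in initial S,
        forall i, (rho i, tau i, rho i.+1) \in trans S
      & omega_label S tau sigma].

Definition omega_detectable S (k1 k2 : nat) : Prop :=
  forall sigma, omega_language S sigma ->
  forall sigma1 sigma2 : seq Sigma, omega_prefix (sigma1 ++ sigma2) sigma ->
  k1 <= size sigma1 -> k2 <= size sigma2 ->
  #|delayed_estimate S sigma1 sigma2| = 1.

Definition star_detectable S (k1 k2 : nat) : Prop :=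
  forall w : seq Sigma, language S w ->
  forall sigma1 sigma2 : seq Sigma, prefix (sigma1 ++ sigma2) w ->
  k1 <= size sigma1 -> k2 <= size sigma2 ->
  #|delayed_estimate S sigma1 sigma2| = 1.

(* [Tc] is the set of controllable events; its complement is the set of
   uncontrollable ones. *)
Definition controllable_trans S (Tc : {set T}) : {set X * T * X} :=
  [set e in trans S | e.1.2 \in Tc].

Definition disable S (D : {set X * T * X}) : fsa X T Sigma :=
  Fsa (initial S) (trans S :\: D) (label S).

End Automata.

(** * Random access machines *)

(* The random access machine of Cook and Reckhow over the natural numbers.
   Every instruction costs one unit of time.  As there is no multiplication,
   the largest number at hand (in the registers, the input and the program) at
   most doubles in each step, so polynomial time here is polynomial time on
   Turing machines. *)
Inductive instr :=
| IConst of nat & nat        (* IConst i a:  X_i <- a *)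
| IAdd of nat & nat & nat    (* IAdd i j k:  X_i <- X_j + X_k *)
| ISub of nat & nat & nat    (* ISub i j k:  X_i <- X_j - X_k, truncated at 0 *)
| ILoad of nat & nat         (* ILoad i j:   X_i <- X_(X_j) *)
| IStore of nat & nat        (* IStore i j:  X_(X_i) <- X_j *)
| IJpos of nat & nat         (* IJpos j l:   if X_j > 0 go to line l *)
| IRead of nat.              (* IRead i:     X_i <- next input value, or 0 if
                                             the input is exhausted *)

Definition program := seq instr.

Record config := Config { pc : nat; memory : nat -> nat; input : seq nat }.

Definition upd (m : nat -> nat) (i v : nat) : nat -> nat :=
  fun j => if j == i then v else m j.

Definition exec (c : config) (ins : instr) : config :=
  let: Config l m inp := c in
  match ins with
  | IConst i a => Config l.+1 (upd m i a) inp
  | IAdd i j k => Config l.+1 (upd m i (m j + m k)) inp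
  | ISub i j k => Config l.+1 (upd m i (m j - m k)) inp
  | ILoad i j => Config l.+1 (upd m i (m (m j))) inp
  | IStore i j => Config l.+1 (upd m (m i) (m j)) inp
  | IJpos j l' => Config (if 0 < m j then l' else l.+1) m inp
  | IRead i => Config l.+1 (upd m i (head 0 inp)) (behead inp)
  end.

(* The machine halts by moving the program counter outside the program. *)
Definition step (P : program) (c : config) : config :=
  if onth P (pc c) is Some ins then exec c ins else c.

Definition halted (P : program) (c : config) : bool := size P <= pc c.

Definition start (inp : seq nat) : config := Config 0 (fun=> 0) inp.

(* On input [inp], [P] halts after at most [t] steps with [v] in X_0. *)
Definition outputs_within (P : program) (inp : seq nat) (t v : nat) : Prop :=
  exists2 n, n <= t &
    let c := iter n (step P) (start inp) in halted P c /\ memory c 0 = v.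

(** * Encoding of instances *)

(* States, events and labels are numbered by [enum_rank]; the label [a] of an
   event is coded by [(enum_rank a).+1] and epsilon by 0. *)
Definition encode (X T Sigma : finType) (S : fsa X T Sigma) (Tc : {set T})
    (k1 k2 : nat) : seq nat :=
  [:: #|X|; #|T|; #|Sigma|; #|trans S|; k1; k2]
  ++ [seq nat_of_bool (x \in initial S) | x <- enum X]
  ++ [seq (if label S t is Some a then (enum_rank a).+1 else 0) | t <- enum T]
  ++ [seq nat_of_bool (t \in Tc) | t <- enum T]
  ++ flatten [seq [:: nat_of_ord (enum_rank e.1.1); nat_of_ord (enum_rank e.1.2);
                      nat_of_ord (enum_rank e.2)] | e <- enum (trans S)].

(* Main.v *)
Require Import Defs.
From mathcomp Require Import all_boot all_order all_algebra.
From mathcomp Require Import boolp zify.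

Set Implicit Arguments.
Unset Strict Implicit.
Unset Printing Implicit Defensive.

(* Disabling transitions can only shrink the languages and the delayed
   estimates, so detectability is preserved by disabling more: a suitable set
   exists iff disabling all controllable transitions works, and it remains to
   decide detectability of one automaton.
   That fails iff two runs with the same labels are at different states after
   at least k1 labels and can both read k2 more; for omega-detectability one
   of the two must in addition lie on an infinite run, which by the pigeonhole
   principle means that it can read |X| + 1 further labels.  Both cases are
   reachability questions in a graph whose nodes are triples (level, state,
   state), and a saturation procedure solves them in polynomial time. *)

(** * A loop language compiled to random access machines *)

(** The claim asks for a concrete machine program with a polynomial running time. The search is
    therefore written in a small language whose only loop runs a fixed number [B] of rounds, so that
    a time bound can be read off the syntax. One bound serves all loops: [B] is the size of the
    automaton plus k1 + k2 + 3, which exceeds the number of states and transitions together and also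
    the highest level, k1 + k2 + |X| + 2. As [B] depends on the input, a loop-free header computes
    it before any loop starts. Silent events shape the pair graph: runs with equal labels may differ
    in their number of events. Hence one run may wait while the other moves silently, and levels
    count labels, not events. The pigeonhole argument counts labels too, so that the cycle found
    emits at least one label and going round it forever yields an infinite word. *)

Inductive expr :=
| Cst of nat
| Plus of expr & expr
| Minus of expr & expr
| Cell of nat & expr.

Inductive cmd :=
| Put of nat & expr & expr
| Read of nat & expr
| Chain of cmd & cmd
| When of expr & cmd
| Loop of nat & cmd.

Record state := State { cell : nat -> nat -> nat; rest : seq nat }.

Definition put (b i v : nat) (s : state) : state :=
  State (fun b' i' => if (b' == b) && (i' == i) then v else cell s b' i')
        (rest s).

Fixpoint eval (s : state) (e : expr) : nat :=
  match e with
  | Cst a => a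
  | Plus e1 e2 => eval s e1 + eval s e2
  | Minus e1 e2 => eval s e1 - eval s e2
  | Cell b e1 => cell s b (eval s e1)
  end.

(** The variable that holds the bound shared by all loops of a program. *)
Definition Bvar := 1.

Definition bump_var (v : nat) (s : state) := put 0 v (cell s 0 v).+1 s.

Fixpoint sem (c : cmd) (s : state) : state :=
  match c with
  | Put b e1 e2 => put b (eval s e1) (eval s e2) s
  | Read b e => put b (eval s e) (head 0 (rest s)) (State (cell s) (behead (rest s)))
  | Chain c1 c2 => sem c2 (sem c1 s)
  | When e c1 => if 0 < eval s e then sem c1 s else s
  | Loop v c1 =>
      iter (cell s 0 Bvar) (fun s' => bump_var v (sem c1 s')) (put 0 v 0 s)
  end.

(** A literal index pins down one cell, while a computed index may hit the whole bank. This
    over-approximation is decided by the syntax, so most frame conditions below hold by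
    computation. *)
Definition may_touch (b : nat) (e : expr) (b' i : nat) : bool :=
  (b' == b) && (if e is Cst j then i == j else true).

Fixpoint writes (c : cmd) (b i : nat) : bool :=
  match c with
  | Put b' e _ => may_touch b' e b i
  | Read b' e => may_touch b' e b i
  | Chain c1 c2 => writes c1 b i || writes c2 b i
  | When _ c1 => writes c1 b i
  | Loop v c1 => (b == 0) && (i == v) || writes c1 b i
  end.

Lemma sem_frame c s b i : ~~ writes c b i -> cell (sem c s) b i = cell s b i.
Proof.
have touch b' e s' : ~~ may_touch b' e b i ->
    (b == b') && (i == eval s' e) = false.
  by rewrite /may_touch; case: eqP => //= _; case: e => //= j /negbTE.
elim: c s => [b' e e2|b' e|c1 IH1 c2 IH2|e c1 IH|v c1 IH] s /=.
- by move/touch=> ->.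
- by move=> /touch; move/(_ s)=> ->.
- by rewrite negb_or => /andP[w1 w2]; rewrite IH2 // IH1.
- by move=> w; case: ifP => // _; rewrite IH.
- rewrite negb_or => /andP[/negbTE nv w].
  by elim: (cell s 0 Bvar) => [|k IHk] /=; rewrite nv // IH.
Qed.

Fixpoint loop_free (c : cmd) : bool :=
  match c with
  | Chain c1 c2 => loop_free c1 && loop_free c2
  | When _ c1 => loop_free c1
  | Loop _ _ => false
  | _ => true
  end.

(* The compiled loop re-reads its counter and the bound [Bvar] before each
   round, so the body may change neither. *)
Fixpoint wf (c : cmd) : bool :=
  match c with
  | Put b _ _ => (b < 16) && (b != 1)
  | Read b _ => (b < 16) && (b != 1)
  | Chain c1 c2 => wf c1 && wf c2
  | When _ c1 => wf c1
  | Loop v c1 => [&& wf c1, ~~ writes c1 0 v, ~~ writes c1 0 Bvar & v != Bvar]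
  end.

Fixpoint wfe (e : expr) : bool :=
  match e with
  | Cst _ => true
  | Plus e1 e2 => wfe e1 && wfe e2
  | Minus e1 e2 => wfe e1 && wfe e2
  | Cell b e1 => [&& b < 16, b != 1 & wfe e1]
  end.

Fixpoint wfes (c : cmd) : bool :=
  match c with
  | Put _ e1 e2 => wfe e1 && wfe e2
  | Read _ e => wfe e
  | Chain c1 c2 => wfes c1 && wfes c2
  | When e c1 => wfe e && wfes c1
  | Loop _ c1 => wfes c1
  end.

(* The memory is split into 16 interleaved banks; bank 0 holds the variables
   and bank 1 the evaluation stack. *)
Definition addr (b i : nat) : nat := 16 * i + b.

Definition stk (d : nat) : nat := addr 1 d.

(* replaces the index on top of the stack by its address in bank [b] *)
Definition to_addr (d b : nat) : seq instr :=
  nseq 4 (IAdd (stk d) (stk d) (stk d)) ++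
  [:: IConst (stk d.+1) b; IAdd (stk d) (stk d) (stk d.+1)].

Arguments to_addr : simpl never.

(** [d] is the stack depth: the value is left in [stk d], and only stack cells from [d] on serve as
    scratch space. A second operand is evaluated at depth [d.+1], which preserves the first. *)
Fixpoint compile_expr (d : nat) (e : expr) : seq instr :=
  match e with
  | Cst a => [:: IConst (stk d) a]
  | Plus e1 e2 => compile_expr d e1 ++ compile_expr d.+1 e2 ++
                 [:: IAdd (stk d) (stk d) (stk d.+1)]
  | Minus e1 e2 => compile_expr d e1 ++ compile_expr d.+1 e2 ++
                 [:: ISub (stk d) (stk d) (stk d.+1)]
  | Cell b e1 =>
      (compile_expr d e1 ++ to_addr d b) ++ [:: ILoad (stk d) (stk d)]
  end.

Definition compile_put (b : nat) (e1 e2 : expr) : seq instr :=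
  compile_expr 0 e1 ++ to_addr 0 b ++ compile_expr 1 e2 ++
  [:: IStore (stk 0) (stk 1)].

Definition compile_read (b : nat) (e : expr) : seq instr :=
  compile_expr 0 e ++ to_addr 0 b ++
  [:: IRead (stk 1); IStore (stk 0) (stk 1)].

Definition goto (l : nat) : seq instr := [:: IConst (stk 0) 1; IJpos (stk 0) l].

Definition set_var (v : nat) (e : expr) : seq instr := compile_put 0 (Cst v) e.

Definition incr_var (v : nat) : seq instr :=
  set_var v (Plus (Cell 0 (Cst v)) (Cst 1)).

Definition loop_test (v : nat) : seq instr :=
  compile_expr 0 (Minus (Cell 0 (Cst Bvar)) (Cell 0 (Cst v))).

(** Jumps are absolute, so [l] is the line at which the code will stand. A test is followed by a
    jump to the body and by a [goto] of two instructions past it, whence the offset 3. *)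
Fixpoint compile (l : nat) (c : cmd) : program :=
  match c with
  | Put b e1 e2 => compile_put b e1 e2
  | Read b e => compile_read b e
  | Chain c1 c2 => let p1 := compile l c1 in p1 ++ compile (l + size p1) c2
  | When e c1 =>
      let pe := compile_expr 0 e in
      let l1 := l + size pe + 3 in
      let p1 := compile l1 c1 in
      pe ++ IJpos (stk 0) l1 :: goto (l1 + size p1) ++ p1
  | Loop v c1 =>
      let p0 := set_var v (Cst 0) in
      let pt := loop_test v in
      let l0 := l + size p0 in
      let l1 := l0 + size pt + 3 in
      let p1 := compile l1 c1 in
      let pi := incr_var v in
      p0 ++ pt ++ IJpos (stk 0) l1 :: goto (l1 + size p1 + size pi + 2)
        ++ p1 ++ pi ++ goto l0
  end.

(** * Correctness of the compilation *)

Definition jump_free (ins : instr) : bool := if ins is IJpos _ _ then false else true.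

Lemma step_at P1 ins P2 c : pc c = size P1 ->
  step (P1 ++ ins :: P2) c = exec c ins.
Proof.
by move=> e; rewrite /step e onth_cat ltnn subnn.
Qed.

Lemma iter_jump_free C P1 P2 c : all jump_free C -> pc c = size P1 ->
  iter (size C) (step (P1 ++ C ++ P2)) c = foldl exec c C.
Proof.
elim: C P1 c => //= ins C IH P1 c /andP[ji jC] e.
rewrite -iterS iterSr step_at // -cat_rcons IH //.
by rewrite size_rcons; case: ins ji => //=; case: c e => l m i /= ->.
Qed.

Lemma jump_free_expr d e : all jump_free (compile_expr d e).
Proof.
by elim: e d => //= [e1 IH1 e2 IH2|e1 IH1 e2 IH2|b e1 IH1] d;
  rewrite !all_cat IH1 ?IH2.
Qed.

Lemma jump_free_put b e1 e2 : all jump_free (compile_put b e1 e2).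
Proof. by rewrite !all_cat !jump_free_expr. Qed.

Lemma jump_free_read b e : all jump_free (compile_read b e).
Proof. by rewrite !all_cat !jump_free_expr. Qed.

(** Only stack cells of depth at least [d] may differ; all other addresses, in every bank, keep
    their contents. *)
Definition same_below (d : nat) (m m' : nat -> nat) : Prop :=
  forall a, (forall d', d <= d' -> a <> stk d') -> m' a = m a.

Definition represents (m : nat -> nat) (s : state) : Prop :=
  forall b i, b < 16 -> b != 1 -> m (addr b i) = cell s b i.

Lemma same_below_stk d d' m m' : same_below d m m' -> d' < d ->
  m' (stk d') = m (stk d').
Proof. by move=> H lt; apply: H => d2 le2; rewrite /stk /addr; lia. Qed.

Lemma same_below_trans d d' m m' m'' : d <= d' ->
  same_below d m m' -> same_below d' m' m'' -> same_below d m m''.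
Proof.
move=> le H H' a Ha; rewrite (H' a) ?(H a) // => d2 le2.
by apply: Ha; apply: leq_trans le2.
Qed.

Lemma same_below_upd d d' v m : d <= d' -> same_below d m (upd m (stk d') v).
Proof. by move=> le a Ha; rewrite /upd; case: eqP => // /Ha-/(_ le). Qed.

Lemma represents_same d m m' s :
  represents m s -> same_below d m m' -> represents m' s.
Proof.
move=> R H b i b16 b1; rewrite H ?R // => d' _; rewrite /stk /addr; lia.
Qed.

(** Scaling has to be done by additions; k = 4 gives the factor 16 of [addr]. *)
Lemma doublingE k d l m inp : exists m',
  [/\ foldl exec (Config l m inp) (nseq k (IAdd (stk d) (stk d) (stk d))) =
        Config (l + k) m' inp,
      same_below d m m' & m' (stk d) = 2 ^ k * m (stk d)].
Proof.
elim: k l m => [|k IH] l m; first by exists m; rewrite addn0 mul1n.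
have [m' [E S V]] := IH l.+1 (upd m (stk d) (m (stk d) + m (stk d))).
exists m'; split.
- by rewrite /= E addnS.
- exact: same_below_trans (leqnn d) (same_below_upd _ _ (leqnn d)) S.
- by rewrite V /upd eqxx addnn -mul2n mulnA expnSr.
Qed.

Lemma to_addrE d b l m inp : exists m',
  [/\ foldl exec (Config l m inp) (to_addr d b) =
        Config (l + size (to_addr d b)) m' inp,
      same_below d m m' & m' (stk d) = addr b (m (stk d))].
Proof.
have nd : (stk d == stk d.+1) = false by rewrite /stk /addr; lia.
have [m' [E S V]] := doublingE 4 d l m inp.
eexists; split.
- by rewrite foldl_cat E /= !addnS.
- apply: same_below_trans (leqnn d) _ (same_below_upd _ _ (leqnn d)).
  exact: same_below_trans (leqnn d) S (same_below_upd _ _ (leqnSn d)).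
- by rewrite /upd !eqxx nd V.
Qed.

(** Expressions write to the stack bank only, so the state remains represented between the
    evaluations of the two operands. *)
Lemma compile_exprE s e d l m inp : wfe e -> represents m s -> exists m',
  [/\ foldl exec (Config l m inp) (compile_expr d e) =
        Config (l + size (compile_expr d e)) m' inp,
      same_below d m m' & m' (stk d) = eval s e].
Proof.
elim: e d l m => [a|e1 IH1 e2 IH2|e1 IH1 e2 IH2|b e1 IH1] d l m /=.
- move=> _ _; exists (upd m (stk d) a); rewrite addn1; split=> //.
  + exact: same_below_upd.
  + by rewrite /upd eqxx.
- move=> /andP[w1 w2] R; have [m1 [E1 S1 V1]] := IH1 d l m w1 R.
  have R1 := represents_same R S1.
  have [m2 [E2 S2 V2]] := IH2 d.+1 (l + size (compile_expr d e1)) m1 w2 R1.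
  eexists; split.
  + by rewrite !foldl_cat E1 E2 /= !size_cat /= addn1 !addnS addnA.
  + apply: (same_below_trans (leqnn d) _ (same_below_upd _ _ (leqnn d))).
    exact: (same_below_trans (leqnSn d) S1 S2).
  + by rewrite /upd eqxx V2 (same_below_stk S2) // V1.
- move=> /andP[w1 w2] R; have [m1 [E1 S1 V1]] := IH1 d l m w1 R.
  have R1 := represents_same R S1.
  have [m2 [E2 S2 V2]] := IH2 d.+1 (l + size (compile_expr d e1)) m1 w2 R1.
  eexists; split.
  + by rewrite !foldl_cat E1 E2 /= !size_cat /= addn1 !addnS addnA.
  + apply: (same_below_trans (leqnn d) _ (same_below_upd _ _ (leqnn d))).
    exact: (same_below_trans (leqnSn d) S1 S2).
  + by rewrite /upd eqxx V2 (same_below_stk S2) // V1.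
- move=> /and3P[b16 b1 w1] R; have [m1 [E1 S1 V1]] := IH1 d l m w1 R.
  have [m2 [E2 S2 V2]] := to_addrE d b (l + size (compile_expr d e1)) m1 inp.
  have S3 := same_below_trans (leqnn d) S1 S2.
  have R2 := represents_same R S3.
  eexists; split.
  + rewrite foldl_cat (foldl_cat _ _ (compile_expr d e1)) E1 E2 /=.
    by rewrite !size_cat /= !addnA addn1.
  + exact: (same_below_trans (leqnn d) S3 (same_below_upd _ _ (leqnn d))).
  + by rewrite /upd eqxx V2 V1 R2.
Qed.

Lemma represents_put m s b i v : b < 16 -> represents m s ->
  represents (upd m (addr b i) v) (put b i v s).
Proof.
move=> b16 R b' i' b16' b1'; rewrite /upd /= -R //.
have -> // : (addr b' i' == addr b i) = (b' == b) && (i' == i).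
rewrite /addr; apply/eqP/andP => [H|[/eqP-> /eqP->]] //.
by split; apply/eqP; lia.
Qed.

Lemma compile_putE b e1 e2 l m inp s : b < 16 -> b != 1 -> wfe e1 -> wfe e2 ->
  represents m s -> exists m',
  foldl exec (Config l m inp) (compile_put b e1 e2) =
    Config (l + size (compile_put b e1 e2)) m' inp /\
  represents m' (put b (eval s e1) (eval s e2) s).
Proof.
move=> b16 b1 w1 w2 R; have [m1 [E1 S1 V1]] := compile_exprE 0 l inp w1 R.
have [m2 [E2 S2 V2]] := to_addrE 0 b (l + size (compile_expr 0 e1)) m1 inp.
have S3 := same_below_trans (leqnn 0) S1 S2.
have R2 := represents_same R S3.
have [m3 [E3 S4 V3]] := compile_exprE 1
  (l + size (compile_expr 0 e1) + size (to_addr 0 b)) inp w2 R2.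
eexists; split.
  by rewrite foldl_cat E1 foldl_cat E2 foldl_cat E3 !(size_cat, addnA) addn1.
rewrite V3 (same_below_stk S4) // V2 V1.
exact: represents_put (represents_same R2 S4).
Qed.

Lemma compile_readE b e l m s : b < 16 -> b != 1 -> wfe e ->
  represents m s -> exists m',
  foldl exec (Config l m (rest s)) (compile_read b e) =
    Config (l + size (compile_read b e)) m' (rest (sem (Read b e) s)) /\
  represents m' (sem (Read b e) s).
Proof.
move=> b16 b1 w R; have [m1 [E1 S1 V1]] := compile_exprE 0 l (rest s) w R.
have [m2 [E2 S2 V2]] := to_addrE 0 b (l + size (compile_expr 0 e)) m1 (rest s).
have S3 := same_below_trans (leqnn 0) S1 S2.
have R2 := represents_same R S3.
eexists; split.
  by rewrite foldl_cat E1 foldl_cat E2 !size_cat !addnA addn2 /= !addnS !addn0.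
rewrite /=; set m3 := upd m2 (stk 1) _.
have -> : m3 (stk 0) = addr b (eval s e) by rewrite /m3 /upd /= V2 V1.
have -> : m3 (stk 1) = head 0 (rest s) by rewrite /m3 /upd eqxx.
have R3 : represents m3 (State (cell s) (behead (rest s))).
  exact: (represents_same R2 (same_below_upd (head 0 (rest s)) m2 (leq0n 1))).
exact: represents_put R3.
Qed.

(** The bound depends on the command and on [B], not on the state: a conditional is charged for its
    body in either case, and a loop for [B] rounds plus the test that ends it. *)
Fixpoint time (B : nat) (c : cmd) : nat :=
  match c with
  | Put b e1 e2 => size (compile_put b e1 e2)
  | Read b e => size (compile_read b e)
  | Chain c1 c2 => time B c1 + time B c2
  | When e c1 => size (compile_expr 0 e) + 3 + time B c1
  | Loop v c1 =>
      size (set_var v (Cst 0)) + size (loop_test v) + 3 +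
      B * (size (loop_test v) + 3 + time B c1 + size (incr_var v) + 2)
  end.

(** Loop-free code may run while the bound is still being computed; any other code must find [B] in
    [Bvar] and leave it there. *)
Definition bounded (B : nat) (c : cmd) (s : state) : bool :=
  loop_free c || ~~ writes c 0 Bvar && (cell s 0 Bvar == B).

Definition reaches P t c c' := exists2 k, k <= t & iter k (step P) c = c'.

Lemma reaches_trans P t1 t2 c1 c2 c3 :
  reaches P t1 c1 c2 -> reaches P t2 c2 c3 -> reaches P (t1 + t2) c1 c3.
Proof.
move=> [k1 le1 <-] [k2 le2 <-]; exists (k2 + k1); last by rewrite iterD.
by rewrite addnC leq_add.
Qed.

Lemma reaches_le P t t' c c' : t <= t' -> reaches P t c c' -> reaches P t' c c'.
Proof. by move=> le [k le1 <-]; exists k => //; apply: leq_trans le1 le. Qed.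

Lemma reaches_jump_free P P1 P2 C l m inp c' : P = P1 ++ C ++ P2 ->
  all jump_free C -> l = size P1 -> foldl exec (Config l m inp) C = c' ->
  reaches P (size C) (Config l m inp) c'.
Proof.
by move=> -> jC e <-; exists (size C) => //; rewrite iter_jump_free.
Qed.

Lemma reaches_goto P P1 P2 l l' m inp s : P = P1 ++ goto l' ++ P2 ->
  l = size P1 -> represents m s ->
  exists m', reaches P 2 (Config l m inp) (Config l' m' inp) /\ represents m' s.
Proof.
move=> -> e R; exists (upd m (stk 0) 1); split; last first.
  exact: represents_same R (same_below_upd _ _ (leqnn 0)).
exists 2 => //; rewrite iterSr step_at //= -cat_rcons step_at /= ?size_rcons ?e //.
Qed.

Lemma reaches_branch P P1 P2 e l1 l2 m inp s :
  P = P1 ++ compile_expr 0 e ++ IJpos (stk 0) l1 :: goto l2 ++ P2 ->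
  wfe e -> represents m s ->
  exists m', reaches P (size (compile_expr 0 e) + 3) (Config (size P1) m inp)
    (Config (if 0 < eval s e then l1 else l2) m' inp) /\ represents m' s.
Proof.
move=> EP w R; have [m1 [E1 S1 V1]] := compile_exprE 0 (size P1) inp w R.
have R1 := represents_same R S1.
have H1 := reaches_jump_free EP (jump_free_expr 0 e) (erefl _) E1.
have H2 : reaches P 1 (Config (size P1 + size (compile_expr 0 e)) m1 inp)
   (Config (if 0 < eval s e then l1
     else (size P1 + size (compile_expr 0 e)).+1) m1 inp).
  by exists 1 => //=; rewrite EP catA step_at /= ?V1 // size_cat.
have H3 := reaches_trans H1 H2.
case: ifP H3 => _ H3.
  by exists m1; split=> //; apply: reaches_le H3; lia.
have [|||m2 [H4 R2]] := @reaches_goto P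
  (P1 ++ compile_expr 0 e ++ [:: IJpos (stk 0) l1]) P2
  (size P1 + size (compile_expr 0 e)).+1 l2 m1 inp s.
- by rewrite EP -!catA.
- by rewrite !size_cat /= addn1 addnS.
- by [].
by exists m2; split=> //; apply: reaches_le (reaches_trans H3 H4); lia.
Qed.

Lemma size_goto l : size (goto l) = 2. Proof. by []. Qed.

Opaque set_var loop_test incr_var goto.

(** A simulation by induction on the command, for code placed anywhere in a program. Since
    [represents] ignores the stack bank, every construct is free to overwrite its scratch cells. *)
Theorem compileE B c s P P1 P2 m : P = P1 ++ compile (size P1) c ++ P2 ->
  wf c -> wfes c -> bounded B c s -> represents m s ->
  exists m', reaches P (time B c) (Config (size P1) m (rest s))
     (Config (size P1 + size (compile (size P1) c)) m' (rest (sem c s)))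
   /\ represents m' (sem c s).
Proof.
elim: c s P1 P2 m => [b e1 e2|b e|c1 IH1 c2 IH2|e c1 IH|v c1 IH] s P1 P2 m EP /=.
- move=> /andP[b16 b1] /andP[w1 w2] _ R.
  have [m' [E R']] := compile_putE (size P1) (rest s) b16 b1 w1 w2 R.
  exists m'; split=> //.
  exact: (reaches_jump_free EP (jump_free_put _ _ _)).
- move=> /andP[b16 b1] w _ R.
  have [m' [E R']] := compile_readE (size P1) b16 b1 w R.
  exists m'; split=> //.
  exact: (reaches_jump_free EP (jump_free_read _ _)).
- move=> /andP[w1 w2] /andP[we1 we2] bd R.
  have bd1 : bounded B c1 s.
    move: bd; rewrite /bounded /= negb_or => /orP[/andP[-> _]//|].
    by move=> /andP[/andP[-> _] ->]; rewrite orbT.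
  have bd2 : bounded B c2 (sem c1 s).
    move: bd; rewrite /bounded /= negb_or => /orP[/andP[_ ->]//|].
    by move=> /andP[/andP[w ->] E]; rewrite sem_frame // E orbT.
  rewrite /= -catA in EP.
  have [m1 [H1 R1]] := IH1 s P1 _ m EP w1 we1 bd1 R.
  rewrite catA -size_cat in EP.
  have [m2 [H2 R2]] := IH2 _ _ _ m1 EP w2 we2 bd2 R1.
  exists m2; split=> //; rewrite size_cat addnA.
  apply: (reaches_trans H1); rewrite -size_cat; exact: H2.
- move=> w /andP[we we1] bd R.
  rewrite /= -!catA /= in EP.
  have [m1 [H1 R1]] := reaches_branch (rest s) EP we R.
  have szc : size P1 + size (compile (size P1) (When e c1)) =
      size P1 + size (compile_expr 0 e) + 3 +
      size (compile (size P1 + size (compile_expr 0 e) + 3) c1).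
    by rewrite /= size_cat /= size_cat size_goto; lia.
  rewrite /= in szc.
  case: ifP H1 => pos H1.
    set P3 := P1 ++ compile_expr 0 e ++ IJpos (stk 0)
      (size P1 + size (compile_expr 0 e) + 3) :: goto
      (size P1 + size (compile_expr 0 e) + 3 +
       size (compile (size P1 + size (compile_expr 0 e) + 3) c1)).
    have sz : size P3 = size P1 + size (compile_expr 0 e) + 3.
      by rewrite !size_cat /= addnA.
    have EP3 : P = P3 ++ compile (size P3) c1 ++ P2.
      by rewrite sz EP /P3 -!catA /=.
    have [m2 [H2 R2]] := IH s P3 P2 m1 EP3 w we1 bd R1.
    exists m2; split=> //.
    rewrite sz in H2; have := reaches_trans H1 H2.
    by rewrite szc.
  exists m1; split=> //.
  by rewrite szc; apply: reaches_le (leq_addr (time B c1) _) H1.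
- move=> /and4P[w wv wB vB] we bd R.
  have vB' : Bvar != v by rewrite eq_sym.
  have EB : cell s 0 Bvar = B.
    by move: bd; rewrite /bounded /= => /andP[_ /eqP].
  rewrite EB.
  set p0 := set_var v (Cst 0) in EP *; set pt := loop_test v in EP *.
  set l0 := size P1 + size p0 in EP *.
  set l1 := l0 + size pt + 3 in EP *.
  set p1 := compile l1 c1 in EP *; set pi := incr_var v in EP *.
  set l2 := l1 + size p1 + size pi + 2 in EP *.
  have EP1 : P = P1 ++ p0 ++ (pt ++ IJpos (stk 0) l1 :: goto l2 ++
      (p1 ++ pi ++ goto l0 ++ P2)).
    by rewrite EP /= -!catA /= -!catA.
  have szF : size P1 + size (compile (size P1) (Loop v c1)) = l2.
    have sz x (a b c d g h : seq instr) :
        size (a ++ b ++ x :: g ++ c ++ d ++ h) =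
        size a + size b + 1 + size g + size c + size d + size h.
      by rewrite !(size_cat, addnA) /= !size_cat; lia.
    by rewrite /= sz !size_goto -/p0 -/pt -/l0 -/l1 -/p1 -/pi /l2 /l1 /l0; lia.
  rewrite /= in szF.
  Transparent set_var loop_test incr_var goto.
  have [m0 [E0 R0]] := @compile_putE 0 (Cst v) (Cst 0) (size P1) m (rest s) s
    isT isT isT isT R.
  have J0 : all jump_free p0 by exact: jump_free_put.
  have H0 : reaches P (size p0) _ (Config l0 m0 (rest s)) :=
    reaches_jump_free EP1 J0 (erefl _) E0.
  rewrite /= in R0.
  (* Induction on the number [k] of remaining rounds. That the counter plus [k] equals [B] makes the
     test positive exactly while rounds remain; the term outside the product pays for the final
     test. *)
  have key k s1 m1 : represents m1 s1 -> cell s1 0 Bvar = B ->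
    cell s1 0 v + k = B ->
    exists m2, reaches P
      (size pt + 3 + k * (size pt + 3 + time B c1 + size pi + 2))
      (Config l0 m1 (rest s1))
      (Config l2 m2 (rest (iter k (fun s' => bump_var v (sem c1 s')) s1)))
      /\ represents m2 (iter k (fun s' => bump_var v (sem c1 s')) s1).
    have sz0 : size (P1 ++ p0) = l0 by rewrite size_cat.
    have EP0 : P = (P1 ++ p0) ++ pt ++ IJpos (stk 0) l1 :: goto l2 ++
        (p1 ++ pi ++ goto l0 ++ P2).
      by rewrite EP1 -!catA.
    elim: k s1 m1 => [|k IHk] s1 m1 R1 EB1 EV1.
      have [//|m2 [H2 R2]] := reaches_branch (rest s1) EP0 _ R1.
      rewrite sz0 in H2; exists m2; rewrite mul0n addn0; split=> //.
      by move: H2; rewrite /= EB1 -EV1 addn0 subnn.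
    have [//|m2 [H2 R2]] := reaches_branch (rest s1) EP0 _ R1.
    rewrite sz0 /= EB1 -EV1 addKn /= in H2.
    set P3 := (P1 ++ p0) ++ pt ++ IJpos (stk 0) l1 :: goto l2.
    have sz3 : size P3 = l1 by rewrite size_cat sz0 size_cat /= addnA.
    have EP3 : P = P3 ++ compile (size P3) c1 ++ (pi ++ goto l0 ++ P2).
      by rewrite sz3 EP0 /P3 -!catA /=.
    have bd1 : bounded B c1 s1 by rewrite /bounded wB EB1 eqxx orbT.
    have [m3 [H3 R3]] := IH s1 P3 _ m2 EP3 w we bd1 R2.
    rewrite sz3 -/p1 in H3.
    have [m4 [E4 R4]] := @compile_putE 0 (Cst v)
      (Plus (Cell 0 (Cst v)) (Cst 1)) (l1 + size p1) m3 (rest (sem c1 s1))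
      _ isT isT isT isT R3.
    have {}E4 : foldl exec (Config (l1 + size p1) m3 (rest (sem c1 s1))) pi =
      Config (l1 + size p1 + size pi) m4 (rest (sem c1 s1)) := E4.
    have {}R4 : represents m4 (bump_var v (sem c1 s1)).
      by rewrite /bump_var -addn1; exact: R4.
    have EP4 : P = (P3 ++ p1) ++ pi ++ (goto l0 ++ P2).
      by rewrite EP3 sz3 -!catA.
    have sz4 : l1 + size p1 = size (P3 ++ p1) by rewrite size_cat sz3.
    have H4 : reaches P (size pi) _ _ :=
      reaches_jump_free EP4 (jump_free_put _ _ _) sz4 E4.
    have EP5 : P = ((P3 ++ p1) ++ pi) ++ goto l0 ++ P2 by rewrite EP4 -!catA.
    have [|m5 [H5 R5]] := reaches_goto (rest (sem c1 s1)) EP5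
      (l := l1 + size p1 + size pi) _ R4.
      by rewrite [in RHS]size_cat -sz4.
    have [||m6 [H6 R6]] := IHk _ _ R5.
    + by rewrite /= (negbTE vB') sem_frame.
    + by rewrite /= eqxx sem_frame // addSnnS.
    exists m6; rewrite iterSr; split=> //.
    have {}H2 : reaches P (size pt + 3) _ _ := H2.
    apply: reaches_le (reaches_trans H2 (reaches_trans H3
      (reaches_trans H4 (reaches_trans H5 H6)))).
    by rewrite mulSn; lia.
  have [||m1 [H1 R1]] := key B _ _ R0.
  + by rewrite /= (negbTE vB').
  + by rewrite /= eqxx.
  exists m1; split=> //.
  rewrite szF.
  by apply: reaches_le (reaches_trans H0 H1); lia.
Qed.

(** A loop contributes a factor ['X], so the degree is bounded by the nesting depth. *)
Lemma time_poly c : exists p : {poly nat}, forall B, time B c = (p.[B])%R.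
Proof.
pose C (a : nat) : {poly nat} := (a%:P)%R.
have hC a B : ((C a).[B])%R = a by rewrite hornerC.
elim: c => [b e1 e2|b e|c1 [p1 E1] c2 [p2 E2]|e c1 [p1 E1]|v c1 [p1 E1]] /=.
- by exists (C (size (compile_put b e1 e2))) => B; rewrite hC.
- by exists (C (size (compile_read b e))) => B; rewrite hC.
- by exists (p1 + p2)%R => B; rewrite hornerD E1 E2.
- exists (C (size (compile_expr 0 e) + 3) + p1)%R => B.
  by rewrite hornerD hC E1.
- set a := _ + 3; set a1 := size (loop_test v) + 3; set a2 := size (incr_var v).
  exists (C a + 'X * (C a1 + p1 + C a2 + C 2))%R => B.
  by rewrite hornerD hornerM hornerX !hornerD !hC E1.
Qed.

Definition initial_state (inp : seq nat) : state := State (fun _ _ => 0) inp.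

Definition two_stage (c1 c2 : cmd) : program :=
  let P1 := compile 0 c1 in P1 ++ compile (size P1) c2.

(** The first stage has no loop, so its time is a constant, obtained here with the bound 0. The
    value it leaves in [Bvar] then governs every loop of the second stage. *)
Theorem two_stageE c1 c2 inp s1 : loop_free c1 -> ~~ writes c2 0 Bvar ->
  wf c1 && wfes c1 -> wf c2 && wfes c2 -> s1 = sem c1 (initial_state inp) ->
  outputs_within (two_stage c1 c2) inp
    (time 0 c1 + time (cell s1 0 Bvar) c2) (cell (sem c2 s1) 0 0).
Proof.
move=> lf wB /andP[w1 e1] /andP[w2 e2] ->; set s0 := initial_state inp.
have R0 : represents (fun=> 0) s0 by [].
have b1 : bounded 0 c1 s0 by rewrite /bounded lf.
have [m1 [H1 R1]] :=
  @compileE 0 c1 s0 (two_stage c1 c2) [::] _ _ (erefl _) w1 e1 b1 R0.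
have EP : two_stage c1 c2 =
  compile 0 c1 ++ compile (size (compile 0 c1)) c2 ++ [::] by rewrite cats0.
have b2 : bounded (cell (sem c1 s0) 0 Bvar) c2 (sem c1 s0).
  by rewrite /bounded wB eqxx orbT.
have [m2 [H2 R2]] := compileE EP w2 e2 b2 R1.
have [k le E] := reaches_trans H1 H2.
exists k => //=; rewrite -/(start inp) in E; rewrite E /= -R2 //.
by rewrite /halted /= size_cat.
Qed.

(** * Ambiguous runs *)

Section Words.
Variables (X T Sigma : finType) (S : fsa X T Sigma).
Implicit Types (x y z : X) (w u v : seq Sigma) (s : seq T).

Definition word_run x w y : Prop := exists2 s, run S x s y & label_word S s = w.

Lemma run_cat x s1 s2 y :
  reflect (exists2 z, run S x s1 z & run S z s2 y) (run S x (s1 ++ s2) y).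
Proof.
elim: s1 x => [|t s1 IH] x /=.
  by apply: (iffP idP) => [H|[z /eqP-> //]]; exists x.
apply: (iffP existsP) => [[z /andP[tz /IH[z' H1 H2]]]|[z' /existsP[z /andP[tz H1]] H2]].
  by exists z' => //; apply/existsP; exists z; rewrite tz.
by exists z; rewrite tz; apply/IH; exists z'.
Qed.

Lemma label_word_cat s1 s2 :
  label_word S (s1 ++ s2) = label_word S s1 ++ label_word S s2.
Proof. exact: pmap_cat. Qed.

(** The cut is made just before the first label of [v]; silent events at the cut go to the left
    part. *)
Lemma label_word_split s u v : label_word S s = u ++ v ->
  exists s1 s2, [/\ s = s1 ++ s2, label_word S s1 = u & label_word S s2 = v].
Proof.
elim: s u => [|t s IH] u /=.
  by case: u => //= v0; exists [::], [::]; rewrite -v0.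
rewrite /label_word /=; case E: (label S t) => [a|] /=; last first.
  move/IH=> [s1 [s2 [-> L1 L2]]]; exists (t :: s1), s2.
  by rewrite /label_word /= E.
case: u => [|b u] /=.
  by move=> Ev; exists [::], (t :: s); rewrite /label_word /= E.
move=> [<- /IH[s1 [s2 [-> L1 L2]]]]; exists (t :: s1), s2.
by split=> //; rewrite /label_word /= E -L1.
Qed.

Lemma word_run_nil x : word_run x [::] x.
Proof. by exists [::] => //=. Qed.

Lemma word_run_cat x u y v z :
  word_run x u y -> word_run y v z -> word_run x (u ++ v) z.
Proof.
move=> [s1 r1 <-] [s2 r2 <-]; exists (s1 ++ s2); last exact: label_word_cat.
by apply/run_cat; exists y.
Qed.

Lemma word_run_split x u v z : word_run x (u ++ v) z ->
  exists2 y, word_run x u y & word_run y v z.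
Proof.
move=> [s r /label_word_split[s1 [s2 [E L1 L2]]]]; move: r; rewrite E.
by move=> /run_cat[y r1 r2]; exists y; [exists s1|exists s2].
Qed.

Lemma word_run_take n x w z : word_run x w z ->
  exists y, word_run x (take n w) y.
Proof. by rewrite -{1}(cat_take_drop n w) => /word_run_split[y]; exists y. Qed.

Lemma delayed_estimateP x w1 w2 :
  reflect (exists x0 x', [/\ x0 \in initial S, word_run x0 w1 x
                           & word_run x w2 x'])
    (x \in delayed_estimate S w1 w2).
Proof.
rewrite inE; apply: (iffP (asboolP _)).
  move=> [x0 [x' [s1 [s2 [i0 L1 L2 r1 r2]]]]].
  by exists x0, x'; split=> //; [exists s1|exists s2].
move=> [x0 [x' [i0 [s1 r1 L1] [s2 r2 L2]]]].
by exists x0, x', s1, s2.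
Qed.

(* A violation of (k1, k2)-detectability: two runs with the same labels that
   disagree after [w1]; the first can be prolonged by [N] further labels. *)
Definition ambiguous k1 k2 N : Prop :=
  exists x0 y0 x y x' y' z w1 w2 w3,
    [/\ x0 \in initial S, y0 \in initial S & x <> y] /\
    [/\ word_run x0 w1 x, word_run y0 w1 y, word_run x w2 x',
        word_run y w2 y' & word_run x' w3 z] /\
    [/\ k1 <= size w1, size w2 = k2 & size w3 = N].

(** If [y] differed from [x], the first [k2] labels of [w2] would be the common delay, and the rest
    of [w2] followed by [w3] would supply the [N] further labels of the first run. *)
Lemma not_ambiguous k1 k2 N x0 x x' z y w1 w2 w3 :
  ~ ambiguous k1 k2 N -> x0 \in initial S ->
  word_run x0 w1 x -> word_run x w2 x' -> word_run x' w3 z ->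
  k1 <= size w1 -> k2 <= size w2 -> N <= size w3 ->
  y \in delayed_estimate S w1 w2 -> y = x.
Proof.
move=> nam i0 r1 r2 r3 k1w k2w Nw /delayed_estimateP[y0 [y' [j0 q1 q2]]].
case: (x =P y) => // nxy; case: nam.
have [y2 q2'] := word_run_take k2 q2.
move: r2; rewrite -{1}(cat_take_drop k2 w2) => /word_run_split[x2 r2 r2'].
have [z' r4] := word_run_take N (word_run_cat r2' r3).
exists x0, y0, x, y, x2, y2, z', w1, (take k2 w2),
  (take N (drop k2 w2 ++ w3)); split=> //; split=> //.
by rewrite !size_takel // size_cat; lia.
Qed.

Lemma ambiguous_estimate x0 y0 x y x' y' w1 w2 :
  x0 \in initial S -> y0 \in initial S -> x <> y ->
  word_run x0 w1 x -> word_run y0 w1 y -> word_run x w2 x' ->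
  word_run y w2 y' -> #|delayed_estimate S w1 w2| <> 1.
Proof.
move=> i0 j0 nxy r1 q1 r2 q2 /eqP/cards1P[z E]; apply: nxy.
have : x \in delayed_estimate S w1 w2 by apply/delayed_estimateP; exists x0, x'.
have : y \in delayed_estimate S w1 w2 by apply/delayed_estimateP; exists y0, y'.
by rewrite E !inE => /eqP-> /eqP->.
Qed.

(** Finite words ask for no prolongation, so [N] is 0: the word [w1 ++ w2] of an ambiguity is itself
    in the language. Conversely, a run on [w] puts its own state after [w1] into the estimate, and
    unambiguity excludes any other. *)
Lemma star_detectableP k1 k2 : star_detectable S k1 k2 <-> ~ ambiguous k1 k2 0.
Proof.
split=> [det|nam w [x0 [x1 [s [i0 r Lw]]]] w1 w2 /prefixP[w3 Ew] k1w k2w].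
  move=> [x0 [y0 [x [y [x' [y' [z [w1 [w2 [w3 [[i0 j0 nxy]
    [[r1 q1 r2 q2 _] [k1w k2w _]]]]]]]]]]]]].
  apply: (ambiguous_estimate i0 j0 nxy r1 q1 r2 q2).
  have [s rs Ls] := word_run_cat r1 r2.
  by apply: (det (w1 ++ w2)); rewrite ?k2w ?prefix_refl //; exists x0, x', s.
have : word_run x0 (w1 ++ w2 ++ w3) x1 by exists s => //; rewrite Lw Ew catA.
move=> /word_run_split[x r1 /word_run_split[x' r2 r3]].
apply/eqP/cards1P; exists x; apply/setP=> y; rewrite inE.
apply/idP/eqP => [yM|->].
  exact: (not_ambiguous nam i0 r1 r2 r3).
by apply/delayed_estimateP; exists x0, x'.
Qed.

Lemma label_word_prefix s1 s2 : prefix s1 s2 ->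
  prefix (label_word S s1) (label_word S s2).
Proof. by move=> /prefixP[s ->]; rewrite label_word_cat prefix_prefix. Qed.

Lemma run_mkseq (rho : nat -> X) (tau : nat -> T) n :
  (forall i, (rho i, tau i, rho i.+1) \in trans S) ->
  run S (rho 0) (mkseq tau n) (rho n).
Proof.
move=> H; elim: n => [|n IH]; first exact: eqxx.
rewrite /mkseq -[in iota _ _]addn1 iotaD map_cat.
apply/run_cat; exists (rho n) => //=.
by apply/existsP; exists (rho n.+1); rewrite H eqxx.
Qed.

Lemma omega_language_run sigma m : omega_language S sigma ->
  exists x0 x, x0 \in initial S /\ word_run x0 (mkseq sigma m) x.
Proof.
move=> [rho [tau [i0 tr [pre unb]]]]; have [n mn] := unb m.
have r : word_run (rho 0) (label_word S (mkseq tau n)) (rho n).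
  by exists (mkseq tau n) => //; apply: run_mkseq.
have [x rx] := word_run_take m r.
exists (rho 0), x; split=> //; move: rx; rewrite (pre n) /mkseq -map_take.
by rewrite take_iota (minn_idPl mn).
Qed.

(** An infinite run supplies as many further labels as desired, whence an arbitrary [N]. *)
Lemma omega_detectable_if k1 k2 N : ~ ambiguous k1 k2 N -> omega_detectable S k1 k2.
Proof.
move=> nam sigma om w1 w2 pre k1w k2w.
have [x0 [z [i0]]] := omega_language_run (size (w1 ++ w2) + N) om.
rewrite /mkseq iotaD map_cat -/(mkseq _ _) -pre -catA.
move=> /word_run_split[x r1 /word_run_split[x' r2 r3]].
apply/eqP/cards1P; exists x; apply/setP=> y; rewrite inE.
apply/idP/eqP => [yM|->].
  by apply: (not_ambiguous nam i0 r1 r2 r3) => //; rewrite size_map size_iota.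
by apply/delayed_estimateP; exists x0, x'.
Qed.

(** One edge reads exactly one label, however many silent events surround it, so path lengths count
    labels. *)
Definition label_step x y := `[< exists a, word_run x [:: a] y >].

Lemma word_run_path x w z : word_run x w z ->
  exists2 p, path label_step x p & size p = size w.
Proof.
elim: w x => [|a w IH] x; first by exists [::].
rewrite -cat1s => /word_run_split[y ry /IH[p pp sp]].
exists (y :: p); last by rewrite /= sp.
by rewrite /= pp andbT; apply/asboolP; exists a.
Qed.

Lemma path_word_run x p : path label_step x p ->
  exists2 w, word_run x w (last x p) & size w = size p.
Proof.
elim: p x => [|y p IH] x /=; first by exists [::] => //; exact: word_run_nil.
move=> /andP[/asboolP[a ra] /IH[w rw sw]].
by exists (a :: w); [exact: word_run_cat ra rw|rewrite /= sw].
Qed.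

(** A path with at least |X| edges has more than |X| vertices, so two of them coincide. The part in
    between reads one label per edge, which makes [v] nonempty. *)
Lemma long_run_loop x w z : #|X| <= size w -> word_run x w z ->
  exists y u v, [/\ word_run x u y, word_run y v y & 0 < size v].
Proof.
move=> big /word_run_path[p pp sp].
have : ~~ uniq (x :: p).
  apply/negP => /card_uniqP E.
  have : size (x :: p) <= #|X| by rewrite -E max_card.
  by rewrite /= sp ltnNge big.
move=> /(uniqPn x)[i [j [ij jp E]]].
have le : i <= j by exact: ltnW.
have lastn k : k < size (x :: p) -> last x (take k p) = nth x (x :: p) k.
  case: k => [|k] kp; first by rewrite take0.
  by rewrite /= (take_nth x) // last_rcons.
move: pp; rewrite -(cat_take_drop j p) cat_path => /andP[pj _].
have Ej : take j p = take i p ++ drop i (take j p).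
  by rewrite -{1}(cat_take_drop i (take j p)) take_takel.
move: pj; rewrite Ej cat_path => /andP[/path_word_run[u ru _] /path_word_run[v rv sv]].
move: rv; rewrite -last_cat -Ej !lastn //; last exact: ltn_trans ij jp.
rewrite -E => rv; rewrite lastn in ru; last exact: ltn_trans ij jp.
exists (nth x (x :: p) i), u, v; split=> //.
by rewrite sv size_drop size_takel ?subn_gt0.
Qed.

End Words.

(** * Infinite sequences as limits of growing prefixes *)

Section Limit.
Variables (A : Type) (d : A) (L : nat -> seq A).
Hypothesis Lpre : forall k, exists u, L k.+1 = L k ++ u.
Hypothesis Lsize : forall k, k <= size (L k).

(** [L i.+1] has at least [i.+1] entries by [Lsize], so the default is never read. *)
Definition limit (i : nat) : A := nth d (L i.+1) i.

Lemma chain_prefix k j : k <= j -> exists u, L j = L k ++ u.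
Proof.
elim: j => [|j IH]; first by rewrite leqn0 => /eqP->; exists [::]; rewrite cats0.
rewrite leq_eqVlt => /orP[/eqP->|/IH[u E]]; first by exists [::]; rewrite cats0.
by have [v ->] := Lpre j; rewrite E -catA; exists (u ++ v).
Qed.

Lemma limit_prefix k m : m <= size (L k) -> mkseq limit m = take m (L k).
Proof.
move=> le; apply: (@eq_from_nth _ d).
  by rewrite size_mkseq size_takel.
rewrite size_mkseq => i im; rewrite nth_mkseq // nth_take // /limit.
have [[u E]|[u E]] : (exists u, L i.+1 = L k ++ u) \/ (exists u, L k = L i.+1 ++ u).
  by case/orP: (leq_total i.+1 k) => /chain_prefix; [right|left].
- by rewrite E nth_cat (leq_trans im le).
- by rewrite E nth_cat Lsize.
Qed.

End Limit.

(** * Infinite runs obtained by repeating a cycle *)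

Section OmegaWords.
Variables (X T Sigma : finType) (S : fsa X T Sigma).

(** A node is an event with the state it leads to; the event of the source node is ignored. A path
    thus records both the events and the states of a run. *)
Definition move (a b : T * X) : bool := (a.2, b.1, b.2) \in trans S.

Lemma run_path t0 x s y : run S x s y ->
  exists l : seq (T * X),
    [/\ path move (t0, x) l, (last (t0, x) l).2 = y & [seq a.1 | a <- l] = s].
Proof.
elim: s t0 x => [|t s IH] t0 x /=; first by move=> /eqP->; exists [::].
move=> /existsP[z /andP[tr /(IH t)[l [pl ll ml]]]].
by exists ((t, z) :: l); split=> //=; rewrite ?pl ?andbT ?ml.
Qed.

(** After a round the current state is the same, but the node carries the last event of [lv]. The
    last hypothesis says that edges do not look at that event, so the next round can start. *)
Lemma path_loop (e : rel (T * X)) t0 t1 x l0 l1 lv :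
  path e (t0, x) l0 -> last (t0, x) l0 = (t1, l1) ->
  path e (t1, l1) lv -> (last (t1, l1) lv).2 = l1 ->
  (forall t t' a b, e (t, a) b = e (t', a) b) ->
  forall k, path e (t0, x) (l0 ++ flatten (nseq k lv)).
Proof.
move=> p0 E0 pv Ev irr k; rewrite cat_path p0 E0 /=.
elim: k t1 pv Ev {E0} => [|k IH] t pv Ev //=.
rewrite cat_path pv /=; case E: (last _ lv) => [t' y].
rewrite E /= in Ev; rewrite Ev in E *.
apply: IH; first by case: (lv) pv => //= a l; rewrite (irr t' t).
case: (lv) E => [|a l] /=; first by [].
by move=> ->.
Qed.

(** The run follows [s0] and then repeats [sv] forever. Its steps and its labels are separate
    limits, of [C] and of [LL]; the nonempty [v] makes the labels unbounded. *)
Lemma omega_language_loop x0 w y v : x0 \in initial S ->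
  word_run S x0 w y -> word_run S y v y -> 0 < size v ->
  exists2 sigma, omega_language S sigma & omega_prefix w sigma.
Proof.
move=> i0 [s0 r0 L0] [sv rv Lv] v0.
(* The initial node needs some event; one exists because a nonempty [v] comes from a nonempty
   [sv]. *)
have [t0 tsv] : exists t0 : T, True.
  by case: sv Lv {rv} v0 => [<-|t sv] //; exists t.
have [a0 _] : exists a0 : Sigma, True by case: v v0 {Lv} => // a; exists a.
have [l0 [p0 e0 m0]] := run_path t0 r0.
case E0: (last (t0, x0) l0) => [t1 y1]; rewrite E0 /= in e0.
have [lv [pv ev mv]] := run_path t1 rv.
rewrite e0 in E0.
pose C k := l0 ++ flatten (nseq k lv).
have pC : forall k, path move (t0, x0) (C k) by exact: path_loop p0 E0 pv ev _.
have Csucc k : C k.+1 = C k ++ lv.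
  by rewrite /C -addn1 nseqD flatten_cat /= cats0 catA.
pose LL k := label_word S [seq a.1 | a <- C k].
have LLsucc k : LL k.+1 = LL k ++ v.
  by rewrite /LL Csucc map_cat label_word_cat mv Lv.
have LL0 : LL 0 = w by rewrite /LL /C cats0 m0.
have lvpos : 0 < size lv.
  by case: (lv) mv v0 => // mv; rewrite -Lv -mv.
have Csize k : k <= size (C k).
  by elim: k => // k IH; rewrite Csucc size_cat; lia.
have LLsize k : k <= size (LL k).
  by elim: k => // k IH; rewrite LLsucc size_cat; lia.
have limC := @limit_prefix _ (t0, x0) C
  (fun k => ex_intro _ lv (Csucc k)) Csize.
have limLL := @limit_prefix _ a0 LL (fun k => ex_intro _ v (LLsucc k)) LLsize.
set c := limit (t0, x0) C in limC; set sigma := limit a0 LL in limLL.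
(* Entry [i] of [c] holds event [i] and its target, so states are shifted by one and [x0] fills
   position 0. *)
pose tau i := (c i).1; pose rho i := if i is j.+1 then (c j).2 else x0.
have tauE n : mkseq tau n = [seq a.1 | a <- take n (C n)].
  by rewrite -limC // -map_comp.
exists sigma; last by rewrite /omega_prefix (limLL 0) LL0 ?take_size.
exists rho, tau; split=> //.
- move=> i; have pn := pC i.+1.
  rewrite -(cat_take_drop i.+1 (C i.+1)) cat_path -limC // in pn.
  case/andP: pn => /(pathP (t0, x0)) pn _.
  have := pn i; rewrite size_mkseq ltnSn nth_mkseq // => /(_ isT).
  by case: i {pn} => [|i] //=; rewrite nth_mkseq.
- split=> [n|m].
    have /prefixP[u E] : prefix (label_word S (mkseq tau n)) (LL n).
      apply: label_word_prefix; rewrite tauE map_take.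
      by apply/prefixP; exists (drop n [seq a.1 | a <- C n]); rewrite cat_take_drop.
    rewrite /omega_prefix (limLL n) ?E ?take_size_cat //.
    by rewrite size_cat leq_addr.
  exists (size (C m)); rewrite /tau -/(mkseq _ _).
  have -> : mkseq tau (size (C m)) = [seq a.1 | a <- C m].
    by rewrite -[in RHS](take_size (C m)) -limC // -map_comp.
  exact: LLsize.
Qed.

Lemma omega_prefix_catl (u v : seq Sigma) sigma :
  omega_prefix (u ++ v) sigma -> omega_prefix u sigma.
Proof.
rewrite /omega_prefix size_cat /mkseq iotaD map_cat => /eqP.
by rewrite eqseq_cat ?size_map ?size_iota // => /andP[/eqP].
Qed.

(** In an ambiguity the first run reads enough labels after [w2] to enter a cycle that emits labels.
    Repeating the cycle gives an infinite word with prefix [w1 ++ w2], whose estimate contains two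
    states. *)
Lemma omega_detectableP k1 k2 :
  omega_detectable S k1 k2 <-> ~ ambiguous S k1 k2 #|X|.+1.
Proof.
split=> [det|]; last exact: omega_detectable_if.
move=> [x0 [y0 [x [y [x' [y' [z [w1 [w2 [w3 [[i0 j0 nxy]
    [[r1 q1 r2 q2 r3] [k1w k2w Nw]]]]]]]]]]]]].
have [|p [u [v [ru rv v0]]]] := long_run_loop _ r3; first by rewrite Nw.
have [sigma om pre] := omega_language_loop i0
  (word_run_cat (word_run_cat r1 r2) ru) rv v0.
apply: (ambiguous_estimate i0 j0 nxy r1 q1 r2 q2).
apply: (det sigma om) => //; last by rewrite k2w.
exact: omega_prefix_catl pre.
Qed.

End OmegaWords.

(** * Monotonicity under disabling *)

Section Supervision.
Variables (X T Sigma : finType) (S : fsa X T Sigma).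

Lemma ambiguous_disable (D E : {set X * T * X}) k1 k2 N : E \subset D ->
  ambiguous (disable S D) k1 k2 N -> ambiguous (disable S E) k1 k2 N.
Proof.
move=> sED.
have mono x w y : word_run (disable S D) x w y -> word_run (disable S E) x w y.
  move=> [s r L]; exists s => //; elim: s x r {L} => //= t s IH x.
  move=> /existsP[z /andP[tz /IH r]]; apply/existsP; exists z; rewrite r andbT.
  by move: tz; rewrite !inE => /andP[nD ->]; rewrite (contra (subsetP sED _)).
move=> [x0 [y0 [x [y [x' [y' [z [w1 [w2 [w3 [[i0 j0 nxy]
    [[r1 q1 r2 q2 r3] szs]]]]]]]]]]]].
exists x0, y0, x, y, x', y', z, w1, w2, w3; split=> //; split=> //.
by split; apply: mono.
Qed.

Lemma exists_disable (C : {set X * T * X}) k1 k2 N :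
  (exists D : {set X * T * X}, D \subset C /\ ~ ambiguous (disable S D) k1 k2 N)
  <-> ~ ambiguous (disable S C) k1 k2 N.
Proof.
split=> [[D [sDC nam]] /(ambiguous_disable sDC)//|nam].
by exists C.
Qed.

End Supervision.

(* Level [j] counts the labels read so far; the step from [k1] to [k1 + 1]
   marks the point at which the two runs must disagree, and above [KM] only
   the first run still reads labels.  Labels are coded as in [encode]. *)
Definition level_ok (k1 KM j j' a b : nat) (ne : bool) : bool :=
  (a == b) && [|| (a == 0) && (j' == j), [&& a == 0, j == k1, ne & j' == j.+1],
                  [&& 0 < a, j == k1 & j' == j]
                | [&& 0 < a, j != k1, j < KM & j' == j.+1]]
  || [&& KM <= j, 0 < a, b == 0 & j' == j.+1].

(** * Ambiguity as reachability of pairs of states with a level *)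

Section Reachability.
Variables (X T Sigma : finType) (S : fsa X T Sigma) (k1 k2 N : nat).
Let KM := k1 + k2 + 1.

Definition label_code (l : option Sigma) : nat :=
  if l is Some a then (enum_rank a).+1 else 0.

Lemma label_code_inj : injective label_code.
Proof. by move=> [a|] [b|] //= [/ord_inj/enum_rank_inj->]. Qed.

(** Waiting counts as a silent step, so that one run can move while the other stays. *)
Definition estep (l : option Sigma) (x y : X) : Prop :=
  (l = None /\ x = y) \/ exists t, (x, t, y) \in trans S /\ label S t = l.

Inductive reach : nat -> X -> X -> Prop :=
| reach_init x y : x \in initial S -> y \in initial S -> reach 0 x y
| reach_step j x y l l' j' x' y' :
    reach j x y -> estep l x x' -> estep l' y y' ->
    level_ok k1 KM j j' (label_code l) (label_code l') (x' != y') ->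
    reach j' x' y'.

Lemma word_run_step x w y l z : word_run S x w y -> estep l y z ->
  word_run S x (w ++ seq_of_opt l) z.
Proof.
move=> r [[-> <-]|[t [tr <-]]]; first by rewrite cats0.
apply: word_run_cat r _; exists [:: t] => /=.
  by apply/existsP; exists z; rewrite tr /=.
by rewrite /label_word /=; case: (label S t).
Qed.

(** Three phases: before the test of disagreement, while both runs read [w2], and while the first
    alone reads [w3]. At level [k1] the word may be longer than the level. In the last phase [y] is
    left free, since only the state [y2] after [w2] matters. *)
Definition reach_spec j x y : Prop :=
  exists x0 y0, [/\ x0 \in initial S, y0 \in initial S &
  [\/ exists w, [/\ word_run S x0 w x, word_run S y0 w y, j <= k1 & j <= size w],
      exists x1 y1 w1 w2, [/\ x1 <> y1 /\ k1 <= size w1, word_run S x0 w1 x1,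
         word_run S y0 w1 y1, word_run S x1 w2 x /\ word_run S y1 w2 y
       & k1 + 1 + size w2 = j /\ j <= KM]
    | exists x1 y1 x2 y2 w1 w2 w3, [/\ x1 <> y1 /\ k1 <= size w1,
         word_run S x0 w1 x1, word_run S y0 w1 y1,
         word_run S x1 w2 x2 /\ word_run S y1 w2 y2 /\ word_run S x2 w3 x
       & size w2 = k2 /\ KM + size w3 = j]]].

Lemma reach_sound j x y : reach j x y -> reach_spec j x y.
Proof.
elim=> {j x y} [x y ix iy|j x y l l' j' x' y' _ [x0 [y0 [i0 j0 IH]]] ex ey ok].
  by exists x, y; split=> //; constructor 1; exists [::]; split=> //;
    exact: word_run_nil.
exists x0, y0; split=> //.
have codepos (a : option Sigma) : 0 < label_code a -> size (seq_of_opt a) = 1.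
  by case: a.
have code0 (a : option Sigma) : label_code a = 0 -> seq_of_opt a = [::].
  by case: a.
have common : label_code l = label_code l' -> l' = l by move/label_code_inj.
case: IH => [[w [r q jk jw]]|[x1 [y1 [w1 [w2 [[nxy k1w] r1 q1 [r2 q2] [Ej jKM]]]]]]|
  [x1 [y1 [x2 [y2 [w1 [w2 [w3 [[nxy k1w] r1 q1 [r2 [q2 r3]] [s2 Ej]]]]]]]]]].
- have r' := word_run_step r ex; have q' := word_run_step q ey.
  case/orP: ok => [/andP[/eqP/common E ok]|]; last by rewrite /KM; lia.
  rewrite {}E in q'.
  case/or4P: ok => [/andP[_ /eqP->]|/and4P[/eqP/code0 E /eqP Ej ne /eqP->]|
      /and3P[_ /eqP Ej /eqP->]|/and4P[pos nj jKM /eqP->]].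
  + by constructor 1; exists (w ++ seq_of_opt l); split=> //; rewrite size_cat; lia.
  + constructor 2; exists x', y', (w ++ seq_of_opt l), [::]; split=> //.
    * by split; [exact/eqP|rewrite size_cat; lia].
    * by split; apply: word_run_nil.
    * by rewrite /= /KM; lia.
  + by constructor 1; exists (w ++ seq_of_opt l); split=> //; rewrite size_cat; lia.
  + constructor 1; exists (w ++ seq_of_opt l); split=> //; last first.
      by rewrite size_cat codepos //; lia.
    by move/eqP: nj; lia.
- have r' := word_run_step r2 ex; have q' := word_run_step q2 ey.
  case/orP: ok => [/andP[/eqP/common E ok]|/and4P[jK pos /eqP/code0 E /eqP->]].
    rewrite {}E in q'.
    case/or4P: ok => [/andP[/eqP/code0 E /eqP->]|/and4P[_ /eqP]|/and3P[_ /eqP]|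
       /and4P[pos nj jK /eqP->]]; [|lia|lia|].
    + rewrite E cats0 in r' q'.
      by constructor 2; exists x1, y1, w1, w2.
    + constructor 2; exists x1, y1, w1, (w2 ++ seq_of_opt l); split=> //.
      by rewrite size_cat codepos //; lia.
  constructor 3; exists x1, y1, x, y, w1, w2, (seq_of_opt l); split=> //.
    by split=> //; split=> //; exact: word_run_step (word_run_nil _ _) ex.
  by rewrite codepos // /KM; move: jKM jK; rewrite /KM; lia.
- have r' := word_run_step r3 ex.
  (* From [KM] on a common visible step is excluded, so the level grows exactly with the labels of
     the first run. *)
  have keep : j' = j + size (seq_of_opt l).
    case/orP: ok => [/andP[/eqP/common E]|/and4P[_ pos _ /eqP->]].
      case/or4P=> [/andP[/eqP/code0-> /eqP->]|/and4P[_ /eqP]|/and3P[_ /eqP]|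
       /and4P[_ _]]; rewrite /KM in Ej *; try lia.
      by rewrite addn0.
    by rewrite codepos // addn1.
  constructor 3; exists x1, y1, x2, y2, w1, w2, (w3 ++ seq_of_opt l); split=> //.
  by rewrite size_cat keep -Ej addnA.
Qed.

(** The level [KM + N] is too high for the first phase; the second phase can attain it only when [N]
    is 0, with [w3] empty. *)
Lemma reach_ambiguous x y : reach (KM + N) x y -> ambiguous S k1 k2 N.
Proof.
move=> /reach_sound[x0 [y0 [i0 j0 []]]].
- by move=> [w [_ _]]; rewrite /KM; lia.
- move=> [x1 [y1 [w1 [w2 [[nxy k1w] r1 q1 [r2 q2] [Ej jKM]]]]]].
  exists x0, y0, x1, y1, x, y, x, w1, w2, [::]; split=> //; split.
    by split=> //; exact: word_run_nil.
  by move: Ej jKM; rewrite /KM /=; split=> //; lia.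
- move=> [x1 [y1 [x2 [y2 [w1 [w2 [w3 [[nxy k1w] r1 q1 [r2 [q2 r3]] [s2 Ej]]]]]]]]].
  exists x0, y0, x1, y1, x2, y2, x, w1, w2, w3; split=> //; split=> //.
  by split=> //; lia.
Qed.

Lemma estep_refl x : estep None x x. Proof. by left. Qed.

(** [f] gives the level after a number of labels, which covers rising and constant levels alike.
    Induction on the total number of events: a silent event at the head of one run is taken while
    the other waits, until both heads carry the next label. *)
Lemma reach_common (f : nat -> nat) w s1 s2 x y x' y' :
  (forall i a, i < size w -> 0 < a -> forall ne, level_ok k1 KM (f i) (f i.+1) a a ne) ->
  reach (f 0) x y -> run S x s1 x' -> run S y s2 y' ->
  label_word S s1 = w -> label_word S s2 = w -> reach (f (size w)) x' y'.
Proof.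
have eps j ne : level_ok k1 KM j j 0 0 ne by rewrite /level_ok !eqxx.
have [n] := ubnP (size s1 + size s2).
elim: n f w s1 s2 x y => // n IH f w s1 s2 x y sz fok R.
have left_eps t s : label S t = None -> s1 = t :: s ->
    run S x s1 x' -> run S y s2 y' ->
    label_word S s1 = w -> label_word S s2 = w -> reach (f (size w)) x' y'.
  move=> Lt E; rewrite E /label_word /= Lt => /existsP[z /andP[tr r1]] r2 L1 L2.
  apply: (IH f w s s2 z y) => //; first by rewrite E /= in sz; lia.
  by apply: (reach_step (l := None) R _ (estep_refl y) (eps _ _)); right; exists t.
have right_eps t s : label S t = None -> s2 = t :: s ->
    run S x s1 x' -> run S y s2 y' ->
    label_word S s1 = w -> label_word S s2 = w -> reach (f (size w)) x' y'.
  move=> Lt E r1; rewrite E /label_word /= Lt => /existsP[z /andP[tr r2]] L1 L2.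
  apply: (IH f w s1 s x z) => //; first by rewrite E /= in sz; lia.
  by apply: (reach_step (l' := None) R (estep_refl x) _ (eps _ _)); right; exists t.
case E1: s1 => [|t s] r1.
  case E2: s2 => [|t' s'] r2 L1 L2.
    by move: r1 r2 R; rewrite -L1 => /eqP-> /eqP->.
  rewrite -E1 in r1 L1; rewrite -E2 in r2 L2.
  case Lt: (label S t') => [b|]; last exact: (right_eps t' s').
  by move: L1 L2; rewrite E1 E2 /label_word /= Lt /= => <-.
case Lt: (label S t) => [a|] r2 L1 L2; last first.
  by rewrite -E1 in r1 L1; exact: (left_eps t s).
case E2: s2 => [|t' s'] in r2 L2 *.
  by move: L1 L2; rewrite /label_word /= Lt /= => <-.
case Lt': (label S t') => [b|]; last first.
  by rewrite -E1 in r1 L1; rewrite -E2 in r2 L2; exact: (right_eps t' s').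
move: r1 r2 L1 L2; rewrite /label_word /= Lt Lt' /=.
move=> /existsP[z /andP[tr r1]] /existsP[z' /andP[tr' r2]] L1.
rewrite -L1 => -[Eb L2] /=; rewrite -L1 /= in fok.
apply: (IH (fun i => f i.+1) (pmap (label S) s) s s' z z') => //.
- by rewrite E1 E2 /= in sz; lia.
- by move=> i c ic; apply: fok.
apply: (reach_step (l := Some a) (l' := Some a) R).
- by right; exists t.
- by right; exists t'; rewrite -Eb.
- exact: fok.
Qed.

Lemma reach_left j s x y x' : KM <= j -> reach j x y -> run S x s x' ->
  reach (j + size (label_word S s)) x' y.
Proof.
elim: s j x => [|t s IH] j x jK R /=; first by rewrite addn0 => /eqP<-.
move=> /existsP[z /andP[tr r]]; rewrite /label_word /=.
have E : estep (label S t) x z by right; exists t.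
case Lt: (label S t) E => [a|] E /=.
  rewrite addnS -addSn; apply: IH r; first exact: leqW.
  by apply: reach_step R E (estep_refl y) _; rewrite /level_ok jK eqxx orbT.
apply: IH r => //.
by apply: reach_step R E (estep_refl y) _; rewrite /level_ok !eqxx.
Qed.

(** The first [k1] labels of [w1] raise the level, the others are read at the constant level [k1];
    then come the test of disagreement, [w2] and [w3]. *)
Lemma ambiguous_reach : ambiguous S k1 k2 N -> exists x y, reach (KM + N) x y.
Proof.
move=> [x0 [y0 [x [y [x' [y' [z [w1 [w2 [w3 [[i0 j0 nxy]
    [[r1 q1 r2 q2 r3] [k1w k2w Nw]]]]]]]]]]]]].
have R0 := reach_init i0 j0.
have w1E := cat_take_drop k1 w1.
rewrite -w1E in r1 q1.
have [xa [s1 r1a L1] [s2 r1b L2]] := word_run_split r1.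
have [ya [s1' q1a L1'] [s2' q1b L2']] := word_run_split q1.
have R1 : reach k1 xa ya.
  have := reach_common (f := id) _ R0 r1a q1a L1 L1'.
  rewrite size_takel //; apply=> i a ik a0 ne.
  rewrite /level_ok; rewrite /KM; lia.
have R2 : reach k1 x y.
  apply: (reach_common (f := fun=> k1) _ R1 r1b q1b L2 L2') => i a _ a0 ne.
  rewrite /level_ok; lia.
(* Neither run moves: this silent step only certifies that the states differ. *)
have R3 : reach k1.+1 x y.
  apply: (reach_step R2 (estep_refl x) (estep_refl y)).
  by rewrite /level_ok !eqxx /= (introN eqP nxy) orbT.
case: r2 q2 => [s3 r2 L3] [s3' q2 L3'].
have R4 : reach KM x' y'.
  have := reach_common (f := fun i => k1.+1 + i) _ _ r2 q2 L3 L3'.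
  rewrite addn0 k2w /KM addn1 addSn; apply=> // i a ik a0 ne.
  rewrite /level_ok /KM; lia.
case: r3 => [s4 r3 L4]; exists z, y'.
by have := reach_left (leqnn KM) R4 r3; rewrite L4 Nw.
Qed.

Definition edge B (u v : 'I_B * X * X) : bool :=
  `[< exists l l', [/\ estep l u.1.2 v.1.2, estep l' u.2 v.2 &
    level_ok k1 KM u.1.1 v.1.1 (label_code l) (label_code l') (v.1.2 != v.2)] >].

Definition initial_node B (u : 'I_B * X * X) : bool :=
  [&& u.1.1 == 0 :> nat, u.1.2 \in initial S & u.2 \in initial S].

(** Removing cycles leaves a path through distinct nodes, whose length is at most the number of
    nodes. *)
Lemma reach_path B j x y : reach j x y -> forall jB : j < B,
  exists u p, [/\ initial_node u, path (@edge B) u p,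
    last u p = (Ordinal jB, x, y) & size p <= B * #|X| * #|X|].
Proof.
move=> R jB.
suff [u [iu con]] : exists u, initial_node u /\
    connect (@edge B) u (Ordinal jB, x, y).
  case/connectP: con => p pp E; case/shortenP: pp E => p' pp' up' _ E.
  exists u, p'; split=> //.
  have := max_card (mem (u :: p')); move/card_uniqP: up' => -> /=.
  by rewrite !card_prod card_ord => /ltnW.
elim: R jB => {j x y} [x y ix iy jB|j x y l l' j' x' y' R IH ex ey ok jB].
  by exists (Ordinal jB, x, y); rewrite /initial_node ix iy.
(* Levels never decrease, so a derivation that ends below [B] stays below [B] throughout. *)
have le : j <= j' by move: ok; rewrite /level_ok; lia.
have [u [iu con]] := IH (leq_ltn_trans le jB).
exists u; split=> //; apply: connect_trans con (connect1 _).
by apply/asboolP; exists l, l'.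
Qed.

End Reachability.

(** * The decision procedure *)

Lemma cell_put b i v s b' i' :
  cell (put b i v s) b' i' =
  if (b' == b) && (i' == i) then v else cell s b' i'.
Proof. by []. Qed.

(** The Hoare rule for loops: the invariant is indexed by the counter, and its preservation may use
    that cells outside the footprint of the loop still have their original values. *)
Lemma sem_for (I : nat -> state -> Prop) v c s (B := cell s 0 Bvar) :
  ~~ writes c 0 v -> I 0 (put 0 v 0 s) ->
  (forall i s', i < B -> cell s' 0 v = i ->
     (forall b j, ~~ writes (Loop v c) b j -> cell s' b j = cell s b j) ->
     I i s' -> I i.+1 (put 0 v i.+1 (sem c s'))) ->
  I B (sem (Loop v c) s).
Proof.
move=> nw I0 Istep.
suff H k : k <= B -> let s' := iter k (fun s' => bump_var v (sem c s')) (put 0 v 0 s) in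
    [/\ cell s' 0 v = k,
     forall b j, ~~ writes (Loop v c) b j -> cell s' b j = cell s b j & I k s'].
  by have [] := H B (leqnn B).
elim: k => [|k IH] kB /=.
  split=> //; first by rewrite !eqxx.
  by move=> b j /=; rewrite negb_or => /andP[/negbTE-> _].
have [Ev fr Ik] := IH (ltnW kB); set s' := iter k _ _ in Ev fr Ik *.
have Ev' : cell (sem c s') 0 v = k by rewrite sem_frame.
split.
- by rewrite /bump_var /= !eqxx Ev'.
- move=> b j nwj; rewrite /bump_var /=; move: (nwj) => /=.
  by rewrite negb_or => /andP[/negbTE-> nb]; rewrite sem_frame // fr.
- by rewrite /bump_var Ev'; apply: Istep.
Qed.

Definition Var (v : nat) : expr := Cell 0 (Cst v).
(** Truth is a positive value. Truncated subtraction then expresses negation and comparison, and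
    [Plus] is disjunction. *)
Definition eNot (p : expr) := Minus (Cst 1) p.
Definition eLt (a b : expr) := Minus b a.
Definition eLe (a b : expr) := Minus (Plus b (Cst 1)) a.
Definition eEq (a b : expr) := Minus (Cst 1) (Plus (Minus a b) (Minus b a)).
Definition eAnd (p q : expr) := Minus (Cst 1) (Plus (eNot p) (eNot q)).

Definition holds (s : state) (e : expr) : bool := 0 < eval s e.

Lemma holds_not s p : holds s (eNot p) = ~~ holds s p.
Proof. by rewrite /holds /=; lia. Qed.
Lemma holds_lt s a b : holds s (eLt a b) = (eval s a < eval s b).
Proof. by rewrite /holds /=; lia. Qed.
Lemma holds_le s a b : holds s (eLe a b) = (eval s a <= eval s b).
Proof. by rewrite /holds /=; lia. Qed.
Lemma holds_eq s a b : holds s (eEq a b) = (eval s a == eval s b).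
Proof. by rewrite /holds /=; lia. Qed.
Lemma holds_and s p q : holds s (eAnd p q) = holds s p && holds s q.
Proof. by rewrite /holds /=; lia. Qed.
Lemma holds_or s p q : holds s (Plus p q) = holds s p || holds s q.
Proof. by rewrite /holds /=; lia. Qed.

Definition holdsE :=
  (holds_not, holds_lt, holds_le, holds_eq, holds_and, holds_or).

Lemma sem_if e c s : sem (When e c) s = if holds s e then sem c s else s.
Proof. by []. Qed.

(** * Memory layout, input and tables *)

Notation vN := 2 (only parsing).
Notation vM := 3 (only parsing).
Notation vSigma := 4 (only parsing).
Notation vQ := 5 (only parsing).
Notation vK1 := 6 (only parsing).
Notation vK2 := 7 (only parsing).
Notation vK := 8 (only parsing).
Notation vKM := 9 (only parsing).
Notation acc1 := 10 (only parsing).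
Notation acc2 := 11 (only parsing).
Notation bINI := 2 (only parsing).
Notation bLAB := 3 (only parsing).
Notation bCTL := 4 (only parsing).
Notation bSRC := 5 (only parsing).
Notation bEV := 6 (only parsing).
Notation bDST := 7 (only parsing).
Notation bT1 := 8 (only parsing).
Notation bT2 := 9 (only parsing).
Notation bR := 10 (only parsing).

Definition assign (v : nat) (e : expr) : cmd := Put 0 (Cst v) e.

(** The reads follow the order of [encode]. The summand 3 keeps the top level in [vK], at most k1 +
    k2 + |X| + 2, strictly below the bound. *)
Definition header (om : bool) : cmd :=
  Chain (Read 0 (Cst vN)) (Chain (Read 0 (Cst vM)) (Chain (Read 0 (Cst vSigma))
  (Chain (Read 0 (Cst vQ)) (Chain (Read 0 (Cst vK1)) (Chain (Read 0 (Cst vK2))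
  (Chain (assign Bvar (Plus (Var vN) (Plus (Var vM) (Plus (Var vSigma) (Plus (Var vQ)
          (Plus (Var vK1) (Plus (Var vK2) (Cst 3))))))))
  (Chain (assign vKM (Plus (Var vK1) (Plus (Var vK2) (Cst 1))))
       (assign vK (Plus (Var vKM) (if om then Plus (Var vN) (Cst 1) else Cst 0)))))))))).

(** The loop always runs [B] rounds; the test makes the rounds beyond the array idle, so that they
    consume no input. *)
Definition read_array (v b : nat) : cmd :=
  Loop 20 (When (eLt (Var 20) (Var v)) (Read b (Var 20))).

(** The equation covers all indices, with value 0 beyond [L] because the bank starts out empty.
    Event number |T| of the stutters relies on this to be silent and uncontrollable. *)
Lemma read_arrayE v b s L r : v != 20 -> b != 0 -> rest s = L ++ r ->
  size L = cell s 0 v -> size L <= cell s 0 Bvar ->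
  (forall i, cell s b i = 0) ->
  rest (sem (read_array v b) s) = r /\
  forall i, cell (sem (read_array v b) s) b i = nth 0 L i.
Proof.
move=> v20 b0 Er sL LB Z.
have b0' : (0 == b) = false by rewrite eq_sym (negbTE b0).
pose I i s' := rest s' = drop i L ++ r /\
  forall j, cell s' b j = nth 0 (take i L) j.
have [||i s' iB Ei fr [Er' Ec]|] := @sem_for I 20
  (When (eLt (Var 20) (Var v)) (Read b (Var 20))) s.
- by rewrite /= /may_touch b0'.
- split=> /=; first by rewrite drop0.
  by move=> j; rewrite (negbTE b0) Z take0 nth_nil.
- have Ev : cell s' 0 v = size L by rewrite fr ?sL //= /may_touch b0' (negbTE v20).
  rewrite sem_if holds_lt /= Ei Ev; case: ltnP => iL; split=> //=.
  + by rewrite Er' (drop_nth 0 iL).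
  + move=> j; rewrite (negbTE b0) /= eqxx /= Er' (drop_nth 0 iL) /=.
    rewrite (take_nth 0 iL) nth_rcons size_takel ?(ltnW iL) // Ec.
    case: ltngtP => // ij; rewrite nth_default // size_takel // ltnW //.
  + by rewrite Er' !drop_oversize // leqW.
  + by move=> j; rewrite (negbTE b0) /= Ec !take_oversize // leqW.
by rewrite drop_oversize ?take_oversize.
Qed.

Definition read_trans : cmd :=
  Loop 20 (When (eLt (Var 20) (Var vQ))
    (Chain (Read bSRC (Var 20)) (Chain (Read bEV (Var 20)) (Read bDST (Var 20))))).

Lemma read_transE s (L : seq (nat * nat * nat)) (s' := sem read_trans s)
    (d := (0, 0, 0)) :
  rest s = flatten [seq [:: a.1.1; a.1.2; a.2] | a <- L] ->
  size L = cell s 0 vQ -> size L <= cell s 0 Bvar ->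
  forall i, i < size L ->
  [/\ cell s' bSRC i = (nth d L i).1.1, cell s' bEV i = (nth d L i).1.2
    & cell s' bDST i = (nth d L i).2].
Proof.
move=> Er sL LB.
pose I i s' := rest s' = flatten [seq [:: a.1.1; a.1.2; a.2] | a <- drop i L] /\
  forall j, j < i -> j < size L ->
  [/\ cell s' bSRC j = (nth d L j).1.1, cell s' bEV j = (nth d L j).1.2
    & cell s' bDST j = (nth d L j).2].
have [|||_ H] := @sem_for I 20 (When (eLt (Var 20) (Var vQ))
    (Chain (Read bSRC (Var 20)) (Chain (Read bEV (Var 20)) (Read bDST (Var 20))))) s.
- by [].
- by split=> //=; rewrite drop0.
- move=> i t iB Ei fr [Er' Ec].
  have Ev : cell t 0 vQ = size L by rewrite fr ?sL.
  rewrite sem_if holds_lt /= Ei Ev; case: ltnP => iL; split=> //=.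
  + by rewrite Er' (drop_nth d iL).
  + move=> j ji jL; rewrite Er' (drop_nth d iL) /=.
    case: eqP => [-> //|ne] /=; apply: Ec => //; lia.
  + by rewrite Er' !drop_oversize // leqW.
  + by move=> j _ jL; apply: Ec => //; apply: leq_trans jL iL.
by move=> i iL; apply: H => //; apply: leq_trans iL LB.
Qed.

(* Every state gets a silent pseudo-transition to itself: the event number of
   these is |T|, which has neither a label nor a controllability flag. *)
Definition add_stutters : cmd :=
  Loop 20 (When (eLt (Var 20) (Var vN))
    (Chain (Put bSRC (Plus (Var vQ) (Var 20)) (Var 20))
    (Chain (Put bDST (Plus (Var vQ) (Var 20)) (Var 20))
           (Put bEV (Plus (Var vQ) (Var 20)) (Var vM))))).

Lemma add_stuttersE s (s' := sem add_stutters s) (q := cell s 0 vQ) :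
  cell s 0 vN <= cell s 0 Bvar ->
  (forall i, i < q -> [/\ cell s' bSRC i = cell s bSRC i,
     cell s' bEV i = cell s bEV i & cell s' bDST i = cell s bDST i]) /\
  (forall i, i < cell s 0 vN -> [/\ cell s' bSRC (q + i) = i,
     cell s' bEV (q + i) = cell s 0 vM & cell s' bDST (q + i) = i]).
Proof.
move=> nB.
pose I k t :=
  (forall i, i < q -> [/\ cell t bSRC i = cell s bSRC i,
     cell t bEV i = cell s bEV i & cell t bDST i = cell s bDST i]) /\
  (forall i, i < k -> i < cell s 0 vN -> [/\ cell t bSRC (q + i) = i,
     cell t bEV (q + i) = cell s 0 vM & cell t bDST (q + i) = i]).
have [|||H1 H2] := @sem_for I 20 (When (eLt (Var 20) (Var vN))
    (Chain (Put bSRC (Plus (Var vQ) (Var 20)) (Var 20))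
    (Chain (Put bDST (Plus (Var vQ) (Var 20)) (Var 20))
           (Put bEV (Plus (Var vQ) (Var 20)) (Var vM))))) s.
- by [].
- by split.
- move=> k t kB Ek fr [E1 E2].
  have Ev : cell t 0 vN = cell s 0 vN by rewrite fr.
  have Em : cell t 0 vM = cell s 0 vM by rewrite fr.
  have Eq : cell t 0 vQ = q by rewrite fr.
  rewrite sem_if holds_lt /= Ek Ev; case: ltnP => kn; split=> //=.
  + move=> i iq; rewrite !Eq.
    have -> : (i == q + k) = false by lia.
    exact: E1.
  + move=> i ik iN; rewrite !Eq Em eqn_add2l.
    by case: eqP => [-> //|ne] /=; apply: E2 => //; lia.
  + by move=> i ik iN; apply: E2 => //; apply: leq_trans iN kn.
by split=> // i iN; apply: H2 => //; apply: leq_trans iN nB.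
Qed.

(* The machine has no multiplication, so the multiples of B and B^2 needed to
   index [bR] are tabulated. *)
Definition mult_tables : cmd :=
  Loop 20
    (Chain (Put bT1 (Var 20) (Var acc1))
    (Chain (Put bT2 (Var 20) (Var acc2))
    (Chain (assign acc1 (Plus (Var acc1) (Var Bvar)))
           (Loop 21 (assign acc2 (Plus (Var acc2) (Var Bvar))))))).

Lemma mult_tablesE s (s' := sem mult_tables s) (B := cell s 0 Bvar) :
  cell s 0 acc1 = 0 -> cell s 0 acc2 = 0 ->
  forall i, i < B -> cell s' bT1 i = i * B /\ cell s' bT2 i = i * (B * B).
Proof.
move=> Z1 Z2.
pose I k t := [/\ cell t 0 acc1 = k * B, cell t 0 acc2 = k * (B * B) &
  forall i, i < k -> cell t bT1 i = i * B /\ cell t bT2 i = i * (B * B)].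
(* [B] additions of [B] produce the square. *)
have inner t : cell t 0 Bvar = B ->
    cell (sem (Loop 21 (assign acc2 (Plus (Var acc2) (Var Bvar)))) t) 0 acc2 =
    cell t 0 acc2 + B * B.
  move=> EB; rewrite -{1}EB.
  apply: (@sem_for (fun k u => cell u 0 acc2 = cell t 0 acc2 + k * B)) => //.
    by rewrite /= addn0.
  move=> k u _ _ fr E; rewrite /= E fr // EB mulSn; lia.
have [|||_ _ H] := @sem_for I 20
    (Chain (Put bT1 (Var 20) (Var acc1))
    (Chain (Put bT2 (Var 20) (Var acc2))
    (Chain (assign acc1 (Plus (Var acc1) (Var Bvar)))
           (Loop 21 (assign acc2 (Plus (Var acc2) (Var Bvar))))))) s.
- by [].
- by split.
- move=> k t kB Ek fr [E1 E2 E3].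
  have EB : cell t 0 Bvar = B by rewrite fr.
  set c := Loop 21 _.
  pose u := sem (assign acc1 (Plus (Var acc1) (Var Bvar)))
    (sem (Put bT2 (Var 20) (Var acc2)) (sem (Put bT1 (Var 20) (Var acc1)) t)).
  have out b i : (b == 0) && (i == 20) = false -> ~~ writes c b i ->
      cell (put 0 20 k.+1 (sem c u)) b i = cell u b i.
    by move=> E w; rewrite cell_put E sem_frame.
  rewrite -[sem _ t]/(sem c u); split.
  + by rewrite out //= E1 EB mulSn addnC.
  + by rewrite cell_put inner //= E2 mulSn addnC.
  + move=> i ik; rewrite !out //= !Ek E1 E2.
    by case: eqP => [-> //|ne] /=; apply: E3; lia.
by move=> i iB; apply: H.
Qed.

Definition level_expr (k1 KM j j' a b d d' : expr) : expr :=
  let next := eEq j' (Plus j (Cst 1)) in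
  let silent := eEq a (Cst 0) in
  let visible := eLt (Cst 0) a in
  Plus
    (eAnd (eEq a b)
       (Plus (eAnd silent (eEq j' j))
       (Plus (eAnd silent (eAnd (eEq j k1) (eAnd (eNot (eEq d d')) next)))
       (Plus (eAnd visible (eAnd (eEq j k1) (eEq j' j)))
             (eAnd visible (eAnd (eNot (eEq j k1)) (eAnd (eLt j KM) next)))))))
    (eAnd (eLe KM j) (eAnd visible (eAnd (eEq b (Cst 0)) next))).

Lemma holds_level s k1 KM j j' a b d d' :
  holds s (level_expr k1 KM j j' a b d d') =
  level_ok (eval s k1) (eval s KM) (eval s j) (eval s j') (eval s a) (eval s b)
    (eval s d != eval s d').
Proof. by rewrite /level_expr !holdsE /level_ok /= addn1. Qed.

(** A number with digits t, x, y in base [B], the products being looked up in the tables. *)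
Definition index_expr (t x y : expr) : expr :=
  Plus (Plus (Cell bT2 t) (Cell bT1 x)) y.

Definition mark_initial : cmd :=
  Loop 20 (Loop 21
    (When (eAnd (Cell bINI (Var 20)) (Cell bINI (Var 21)))
      (Put bR (index_expr (Cst 0) (Var 20) (Var 21)) (Cst 1)))).

Definition label_of (v : nat) : expr := Cell bLAB (Cell bEV (Var v)).

(** The range covers proper transitions and stutters. Controllable transitions stay in the tables
    and are skipped here, which amounts to disabling all of them. *)
Definition enabled (v : nat) : expr :=
  eAnd (eLt (Var v) (Plus (Var vN) (Var vQ)))
       (eNot (Cell bCTL (Cell bEV (Var v)))).

Definition mark_edge : cmd :=
  When (eAnd (eAnd (enabled 25) (enabled 26))
       (eAnd (Cell bR (index_expr (Var 23) (Cell bSRC (Var 25)) (Cell bSRC (Var 26))))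
         (level_expr (Var vK1) (Var vKM) (Var 23) (Var 24)
            (label_of 25) (label_of 26)
            (Cell bDST (Var 25)) (Cell bDST (Var 26)))))
    (Put bR (index_expr (Var 24) (Cell bDST (Var 25)) (Cell bDST (Var 26)))
       (Cst 1)).

Definition sweep : cmd := Loop 23 (Loop 24 (Loop 25 (Loop 26 mark_edge))).

(* B^3 sweeps suffice: a shortest path visits each of the at most B * |X|^2
   nodes once. *)
Definition saturate : cmd := Loop 20 (Loop 21 (Loop 22 sweep)).

Definition scan : cmd :=
  Loop 20 (Loop 21
    (When (Cell bR (index_expr (Var vK) (Var 20) (Var 21)))
      (assign 0 (Cst 0)))).

Definition answer : cmd := Chain (assign 0 (Cst 1)) scan.

Definition setup : cmd :=
  Chain (read_array vN bINI) (Chain (read_array vM bLAB)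
  (Chain (read_array vM bCTL) (Chain read_trans
  (Chain add_stutters mult_tables)))).

Definition main_cmd : cmd :=
  Chain setup (Chain mark_initial (Chain saturate answer)).

(* the cells that keep their values once [setup] is done: variables from 20 on
   are loop counters, and [bR] is the table of reached nodes *)
Definition protected (b i : nat) : bool := if b == 0 then i < 20 else b < bR.

(** Masking the volatile cells turns preservation of the tables into an equality of functions. *)
Definition static_part (s : state) (b i : nat) : nat :=
  if protected b i then cell s b i else 0.

Lemma static_part_put v x s : 20 <= v -> static_part (put 0 v x s) = static_part s.
Proof.
move=> v20; apply/funext => b; apply/funext => i; rewrite /static_part /protected /=.
by case: (b =P 0) => //= _; case: (i =P v) => //= ->; rewrite ltnNge v20.
Qed.

Lemma static_part_putR i x s : static_part (put bR i x s) = static_part s.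
Proof.
apply/funext => b; apply/funext => j; rewrite /static_part /protected /=.
by case: (b =P bR) => //= ->.
Qed.

(** * Soundness and completeness of the saturation *)

Section Saturation.
Variables (X T Sigma : finType) (S : fsa X T Sigma) (k1 k2 B : nat).
Hypothesis XB : #|X| <= B.
Let KM := k1 + k2 + 1.
Let rank (x : X) : nat := enum_rank x.

(** What the search has to know about the tables. [st_trans] and [st_step] together say that the
    enabled entries are exactly the moves [estep]. *)
Record Static (c : nat -> nat -> nat) : Prop := {
  st_B : c 0 Bvar = B;
  st_bound : c 0 vN + c 0 vQ <= B;
  st_k1 : c 0 vK1 = k1;
  st_KM : c 0 vKM = KM;
  st_T1 : forall i, i < B -> c bT1 i = i * B;
  st_T2 : forall i, i < B -> c bT2 i = i * (B * B);
  st_init : forall i, 0 < c bINI i -> exists2 x, x \in initial S & i = rank x;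
  st_initial : forall x, x \in initial S -> 0 < c bINI (rank x);
  st_trans : forall e, e < c 0 vN + c 0 vQ -> c bCTL (c bEV e) = 0 ->
    exists l x y, [/\ estep S l x y, c bSRC e = rank x, c bDST e = rank y
                    & c bLAB (c bEV e) = label_code l];
  st_step : forall l x y, estep S l x y -> exists e,
    [/\ e < c 0 vN + c 0 vQ, c bCTL (c bEV e) = 0 &
      [/\ c bSRC e = rank x, c bDST e = rank y
        & c bLAB (c bEV e) = label_code l]]
}.

Definition code (j : nat) (x y : X) : nat := j * (B * B) + rank x * B + rank y.

Lemma rank_lt x : rank x < B.
Proof. exact: leq_trans (ltn_ord _) XB. Qed.

(** Uniqueness of digits in base [B]; the leading digit may be arbitrarily large. *)
Lemma index_inj j x y j' x' y' : x < B -> y < B -> x' < B -> y' < B ->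
  j * (B * B) + x * B + y = j' * (B * B) + x' * B + y' ->
  [/\ j = j', x = x' & y = y'].
Proof.
have split i a b : i * (B * B) + a * B + b = (i * B + a) * B + b.
  by rewrite mulnDl mulnA.
have dm a b q r : b < B -> r < B -> a * B + b = q * B + r -> a = q /\ b = r.
  move=> bB rB E; have B0 : 0 < B by exact: leq_ltn_trans bB.
  have := congr1 (modn^~ B) E; rewrite !modnMDl !modn_small // => Eb.
  have := congr1 (divn^~ B) E; rewrite !divnMDl // !divn_small // !addn0.
  by [].
move=> xB yB xB' yB'; rewrite !split => /(dm _ _ _ _ yB yB')[].
by move=> /(dm _ _ _ _ xB xB')[-> ->] ->.
Qed.

Lemma code_inj j x y j' x' y' : code j x y = code j' x' y' ->
  [/\ j = j', x = x' & y = y'].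
Proof.
have rI a b : rank a = rank b -> a = b by move/ord_inj/enum_rank_inj.
by move=> /index_inj[] // ; rewrite ?rank_lt // => -> /rI-> /rI->.
Qed.

Definition marked (s : state) (a : nat) : bool := 0 < cell s bR a.

Definition Sound (s : state) : Prop := forall a, marked s a ->
  exists j x y, [/\ a = code j x y, j < B & reach S k1 k2 j x y].

Variable c0 : nat -> nat -> nat.
Hypothesis st0 : Static c0.

Definition Inv (s : state) : Prop := static_part s = c0 /\ Sound s.

Lemma Inv_static s : Inv s -> Static (static_part s).
Proof. by move=> [->]. Qed.

Lemma Inv_put v x s : 20 <= v -> Inv s -> Inv (put 0 v x s).
Proof. by move=> v20 [st so]; split; rewrite ?static_part_put. Qed.

(** [vs] lists counters of the enclosing loops. Marks are never erased, which is what lets them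
    survive later rounds. *)
Definition sound_cmd (vs : seq nat) (c : cmd) : Prop := forall s, Inv s ->
  all (fun v => cell s 0 v < B) vs ->
  Inv (sem c s) /\ forall a, marked s a -> marked (sem c s) a.

(** The completeness counterpart of [sound_cmd]: [vals] singles out the round of the enclosing loops
    in which the mark is set. *)
Definition hits_cmd (vals : seq (nat * nat)) (c : cmd) (A : seq nat) (b : nat) :=
  forall s, Inv s -> all (fun p => cell s 0 p.1 == p.2) vals ->
  all (marked s) A -> marked (sem c s) b.

Lemma sound_loop v vs c : 20 <= v -> ~~ writes c 0 v ->
  all (fun w => (w != v) && ~~ writes c 0 w) vs ->
  sound_cmd (v :: vs) c -> sound_cmd vs (Loop v c).
Proof.
move=> v20 nw /allP dis sc s inv /allP sm.
have EB : cell s 0 Bvar = B := st_B (Inv_static inv).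
apply: (@sem_for (fun _ s' => Inv s' /\ forall a, marked s a -> marked s' a)) => //.
  by split=> //; apply: Inv_put.
move=> i s' iB Ei fr [inv' mk].
have [|inv2 mk2] := sc s' inv'.
  rewrite /= Ei -EB iB /=; apply/allP => w wv; have /andP[wnv ww] := dis w wv.
  by rewrite fr ?EB ?sm //= (negbTE wnv).
by split; [exact: Inv_put|move=> a /mk/mk2].
Qed.

(** Round [i] sets the mark, and soundness of the body preserves it in the later rounds. *)
Lemma hits_loop v i vals c A b : i < B -> 20 <= v -> ~~ writes c 0 v ->
  all (fun p => [&& p.1 != v, ~~ writes c 0 p.1 & p.2 < B]) vals ->
  sound_cmd (v :: [seq p.1 | p <- vals]) c ->
  hits_cmd ((v, i) :: vals) c A b -> hits_cmd vals (Loop v c) A b.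
Proof.
move=> iB v20 nw /allP dis sc hc s inv /allP vs /allP mA.
have EB : cell s 0 Bvar = B := st_B (Inv_static inv).
have [||_ _] := @sem_for (fun k s' => [/\ Inv s', forall a, marked s a -> marked s' a
   & i < k -> marked s' b]) v c s nw.
- by split=> //; apply: Inv_put.
- move=> k s' kB Ek fr [inv' mk hb].
  have vs' p : p \in vals -> cell s' 0 p.1 = p.2.
    move=> pv; have /and3P[pnv pw _] := dis p pv.
    by rewrite fr /= ?(negbTE pnv) //; apply/eqP/vs.
  have [|inv2 mk2] := sc s' inv'.
    rewrite /= Ek -EB kB /=; apply/allP => _ /mapP[p pv ->].
    by rewrite vs' // EB; have /and3P[] := dis p pv.
  split; [exact: Inv_put|by move=> a /mk/mk2|].
  rewrite ltnS leq_eqVlt => /orP[/eqP E|/hb/mk2//].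
  apply: (hc s' inv'); last by apply/allP => a /mA/mk.
  rewrite /= Ek E eqxx /=; apply/allP => p pv; by rewrite vs'.
- by rewrite EB; apply.
Qed.

Lemma Inv_mark s a j x y : Inv s -> a = code j x y -> j < B ->
  reach S k1 k2 j x y ->
  Inv (put bR a 1 s) /\ forall a', marked s a' -> marked (put bR a 1 s) a'.
Proof.
move=> [st so] E jB R; split; last first.
  by move=> a' m; rewrite /marked /=; case: eqP.
split; first by rewrite static_part_putR.
move=> a'; rewrite /marked /=; case: eqP => [-> _|_ /so//].
by exists j, x, y.
Qed.

Lemma marked_put s a : marked (put bR a 1 s) a.
Proof. by rewrite /marked /= eqxx. Qed.

Lemma sound_initial :
  sound_cmd [:: 21; 20] (When (eAnd (Cell bINI (Var 20)) (Cell bINI (Var 21)))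
      (Put bR (index_expr (Cst 0) (Var 20) (Var 21)) (Cst 1))).
Proof.
move=> s inv /and3P[v21 v20 _]; have st := Inv_static inv; rewrite sem_if holds_and.
case: ifP => // /andP[/(st_init st)[x ix Ex] /(st_init st)[y iy Ey]].
apply: (Inv_mark inv (j := 0) (x := x) (y := y)).
- have T1 := st_T1 st v20; have B0 := leq_ltn_trans (leq0n _) v20.
  have T2 := st_T2 st B0.
  by rewrite /= [cell s bT1 _]T1 [cell s bT2 _]T2 /code [cell s 0 20]Ex [cell s 0 21]Ey.
- exact: leq_ltn_trans v20.
- exact: reach_init.
Qed.

Lemma hits_initial x y : x \in initial S -> y \in initial S ->
  hits_cmd [:: (21, rank y); (20, rank x)]
    (When (eAnd (Cell bINI (Var 20)) (Cell bINI (Var 21)))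
      (Put bR (index_expr (Cst 0) (Var 20) (Var 21)) (Cst 1))) [::]
    (code 0 x y).
Proof.
move=> ix iy s inv /and3P[/eqP E21 /eqP E20 _] _.
have st := Inv_static inv; rewrite /= in E20 E21; rewrite sem_if holds_and /holds /= E20 E21.
have -> : 0 < cell s bINI (rank x) := st_initial st ix.
have -> /= : 0 < cell s bINI (rank y) := st_initial st iy.
have T1 := st_T1 st (rank_lt x); have B0 := leq_ltn_trans (leq0n _) (rank_lt x).
have T2 := st_T2 st B0.
by rewrite /code [cell s bT1 _]T1 [cell s bT2 _]T2 marked_put.
Qed.

Lemma holds_edge s :
  holds s (eAnd (eAnd (enabled 25) (enabled 26))
       (eAnd (Cell bR (index_expr (Var 23) (Cell bSRC (Var 25)) (Cell bSRC (Var 26))))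
         (level_expr (Var vK1) (Var vKM) (Var 23) (Var 24)
            (label_of 25) (label_of 26)
            (Cell bDST (Var 25)) (Cell bDST (Var 26))))) =
  let on e := (e < static_part s 0 vN + static_part s 0 vQ) &&
              (static_part s bCTL (static_part s bEV e) == 0) in
  let e := cell s 0 25 in let f := cell s 0 26 in
  [&& on e, on f,
   marked s (static_part s bT2 (cell s 0 23) + static_part s bT1 (static_part s bSRC e) +
             static_part s bSRC f),
   level_ok (static_part s 0 vK1) (static_part s 0 vKM) (cell s 0 23) (cell s 0 24)
     (static_part s bLAB (static_part s bEV e)) (static_part s bLAB (static_part s bEV f))
     (static_part s bDST e != static_part s bDST f) & true].
Proof.
rewrite (holds_and s (eAnd _ _)) (holds_and s (enabled 25)).
rewrite (holds_and s (Cell _ _)) holds_level /enabled !holds_and.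
rewrite 2!(holds_not s (Cell _ _)) !holds_lt.
by rewrite /holds -!eqn0Ngt andbT -!andbA.
Qed.

(** A mark only says that some reachable node has this code; injectivity of [code] identifies that
    node with the source of the edge. *)
Lemma sound_edge : sound_cmd [:: 26; 25; 24; 23] mark_edge.
Proof.
move=> s inv /and5P[_ _ v24 v23 _]; have so := inv.2.
have st := Inv_static inv.
rewrite /mark_edge sem_if holds_edge.
case: ifP => // /and5P[/andP[e1 /eqP c1] /andP[e2 /eqP c2] mk ok _].
have [l [x [x' [ex sx dx lx]]]] := st_trans st e1 c1.
have [l' [y [y' [ey sy dy ly]]]] := st_trans st e2 c2.
rewrite /= sx sy in mk; rewrite lx ly dx dy in ok.
rewrite (st_k1 st) (st_KM st) in ok.
have T1m a : static_part s bT1 (rank a) = rank a * B := st_T1 st (rank_lt a).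
have T2m i : i < B -> static_part s bT2 i = i * (B * B) := st_T2 st (i := i).
rewrite T1m T2m // in mk; rewrite /static_part /= in dx dy.
have T1 a : cell s bT1 (rank a) = rank a * B := st_T1 st (rank_lt a).
have T2 i : i < B -> cell s bT2 i = i * (B * B) := st_T2 st (i := i).
have [j [x1 [y1 [E jB R]]]] := so _ mk.
rewrite -/(code _ x y) in E; have [Ej Ex Ey] := code_inj E.
apply: (Inv_mark inv (j := cell s 0 24) (x := x') (y := y')).
- by rewrite /= dx dy T1 T2.
- by [].
rewrite -Ex -Ey -Ej in R.
apply: (reach_step R ex ey).
by move: ok; rewrite (inj_eq (@ord_inj _)) (inj_eq enum_rank_inj).
Qed.

(** The transition numbers are found in the fixed tables [c0], before any state is given, so they
    can name rounds of the loops. *)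
Lemma hits_edge l l' x y x' y' j j' : j < B -> j' < B ->
  estep S l x x' -> estep S l' y y' ->
  level_ok k1 KM j j' (label_code l) (label_code l') (x' != y') ->
  exists e f, [/\ e < B, f < B & hits_cmd [:: (26, f); (25, e); (24, j'); (23, j)]
    mark_edge [:: code j x y] (code j' x' y')].
Proof.
move=> jB j'B /(st_step st0)[e [eB ce [se de le]]].
move=> /(st_step st0)[f [fB cf [sf df lf]]] ok; exists e, f.
split; [exact: leq_trans eB (st_bound st0)|exact: leq_trans fB (st_bound st0)|].
move=> s [Ec so] /and5P[/eqP E26 /eqP E25 /eqP E24 /eqP E23 _].
rewrite /= in E26 E25 E24 E23; move=> /andP[mk _]; rewrite /mark_edge sem_if holds_edge Ec.
have T1 a : c0 bT1 (rank a) = rank a * B := st_T1 st0 (rank_lt a).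
have T2 i : i < B -> c0 bT2 i = i * (B * B) := st_T2 st0 (i := i).
rewrite /= E23 E24 E25 E26 eB fB ce cf se de le sf df lf !T1 !T2 //.
rewrite (st_k1 st0) (st_KM st0) (inj_eq (@ord_inj _)) (inj_eq enum_rank_inj) ok.
rewrite -/(code j x y) mk /=.
have D1 : cell s bDST e = rank x' by rewrite -de -Ec.
have D2 : cell s bDST f = rank y' by rewrite -df -Ec.
have E1 : cell s bT1 (rank x') = rank x' * B by rewrite -T1 -Ec.
have E2 : cell s bT2 j' = j' * (B * B) by rewrite -T2 // -Ec.
by rewrite D1 D2 E1 E2 marked_put.
Qed.

Lemma sound_sweep : sound_cmd [::] sweep.
Proof. by do 4!apply: sound_loop => //; exact: sound_edge. Qed.

Lemma hits_sweep l l' x y x' y' j j' : j < B -> j' < B ->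
  estep S l x x' -> estep S l' y y' ->
  level_ok k1 KM j j' (label_code l) (label_code l') (x' != y') ->
  hits_cmd [::] sweep [:: code j x y] (code j' x' y').
Proof.
move=> jB j'B ex ey ok; have [e [f [eB fB h]]] := hits_edge jB j'B ex ey ok.
have s26 := sound_edge.
have s25 : sound_cmd [:: 25; 24; 23] (Loop 26 mark_edge) by exact: sound_loop.
have s24 : sound_cmd [:: 24; 23] (Loop 25 (Loop 26 mark_edge)).
  exact: sound_loop.
have s23 : sound_cmd [:: 23] (Loop 24 (Loop 25 (Loop 26 mark_edge))).
  exact: sound_loop.
apply: (@hits_loop 23 j) => //; apply: (@hits_loop 24 j') => //=; first by rewrite jB.
apply: (@hits_loop 25 e) => //=; first by rewrite jB j'B.
by apply: (@hits_loop 26 f) => //=; rewrite jB j'B eB.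
Qed.

Definition initial_marked (s : state) : Prop := forall x y,
  x \in initial S -> y \in initial S -> marked s (code 0 x y).

Lemma mark_initialE s : Inv s ->
  Inv (sem mark_initial s) /\ initial_marked (sem mark_initial s).
Proof.
move=> inv; have s21 := sound_initial.
have s20 : sound_cmd [:: 20] (Loop 21
    (When (eAnd (Cell bINI (Var 20)) (Cell bINI (Var 21)))
      (Put bR (index_expr (Cst 0) (Var 20) (Var 21)) (Cst 1)))).
  exact: sound_loop.
have sf : sound_cmd [::] mark_initial by exact: sound_loop.
split; first by have [] := sf s inv isT.
move=> x y ix iy.
have h : hits_cmd [::] mark_initial [::] (code 0 x y).
  apply: (@hits_loop 20 (rank x)) => //; first exact: rank_lt.
  apply: (@hits_loop 21 (rank y)) => //=; rewrite ?rank_lt //.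
  exact: hits_initial.
exact: h.
Qed.

Definition path_marked (k : nat) (s : state) : Prop := forall u p,
  initial_node S u -> path (@edge _ _ _ S k1 k2 B) u p -> size p <= k ->
  marked s (code (last u p).1.1 (last u p).1.2 (last u p).2).

(** The node before the last edge of a path is already marked, and the sweep applies that edge. *)
Lemma sweep_step k s : Inv s -> path_marked k s ->
  Inv (sem sweep s) /\ path_marked k.+1 (sem sweep s).
Proof.
move=> inv pk; have [inv' mk] := sound_sweep inv isT; split=> //.
move=> u p iu; case: (lastP p) => [_ _|p' v]; first exact/mk/(pk u [::]).
rewrite rcons_path size_rcons last_rcons => /andP[pp ev] sz.
have m := pk u p' iu pp sz; move: ev; case: (last u p') m => [[j x] y].
case: v => [[j' x'] y'] /= m /asboolP[l [l' /= [ex ey ok]]].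
by apply: (hits_sweep _ _ ex ey ok) => //; rewrite /= m.
Qed.

(** A loop multiplies the gain in path length by [B]; three nested loops turn 1 into B^3. *)
Lemma repeat_sweep v c d : 20 <= v -> ~~ writes c 0 v ->
  (forall k s, Inv s -> path_marked k s ->
     Inv (sem c s) /\ path_marked (k + d) (sem c s)) ->
  forall k s, Inv s -> path_marked k s ->
     Inv (sem (Loop v c) s) /\ path_marked (k + B * d) (sem (Loop v c) s).
Proof.
move=> v20 nw hc k s inv pk.
have EB : cell s 0 Bvar = B := st_B (Inv_static inv).
have := @sem_for (fun i s' => Inv s' /\ path_marked (k + i * d) s') v c s nw.
rewrite EB; apply; first by split; [exact: Inv_put|rewrite addn0].
move=> i s' _ _ _ [inv' pk'].
have [inv2 pk2] := hc _ _ inv' pk'.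
by split; [exact: Inv_put|rewrite mulSn [d + _]addnC addnA].
Qed.

Lemma saturateE s : Inv s -> initial_marked s ->
  Inv (sem saturate s) /\
  forall j x y, j < B -> reach S k1 k2 j x y -> marked (sem saturate s) (code j x y).
Proof.
move=> inv im.
have p0 : path_marked 0 s.
  move=> u [|//] /and3P[/eqP j0 ix iy] _ _; rewrite /= j0; exact: im.
have r0 k t := @sweep_step k t.
have r1 := @repeat_sweep 22 sweep 1 isT isT.
have r2 := @repeat_sweep 21 (Loop 22 sweep) (B * 1) isT isT.
have r3 := @repeat_sweep 20 (Loop 21 (Loop 22 sweep)) (B * (B * 1)) isT isT.
have [|inv' pB] := r3 _ 0 s inv p0.
  by apply: r2; apply: r1 => k t; rewrite addn1; exact: r0.
split=> // j x y jB R; have [u [p [iu pp E sz]]] := reach_path R jB.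
have := pB u p iu pp; rewrite E; apply; apply: leq_trans sz _.
by rewrite add0n muln1 -mulnA !leq_mul.
Qed.

(** The scan runs over all pairs of numbers below [B], including those that number no state.
    Soundness of the marks shows that every mark found belongs to a genuine pair. *)
Lemma answerE s : Inv s -> static_part s 0 vK < B ->
  (forall j x y, j < B -> reach S k1 k2 j x y -> marked s (code j x y)) ->
  exists b : bool, cell (sem answer s) 0 0 = b /\
    (b <-> ~ exists x y, reach S k1 k2 (static_part s 0 vK) x y).
Proof.
move=> inv KB mk; have st := Inv_static inv.
set K := static_part s 0 vK in KB *.
pose P x y := marked s (K * (B * B) + x * B + y).
have EB : cell s 0 Bvar = B := st_B st.
have T1 i : i < B -> cell s bT1 i = i * B := st_T1 st (i := i).
have T2 i : i < B -> cell s bT2 i = i * (B * B) := st_T2 st (i := i).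
exists (all (fun x => all (fun y => ~~ P x y) (iota 0 B)) (iota 0 B)); split.
  pose I k (t : state) :=
    cell t 0 0 = all (fun x => all (fun y => ~~ P x y) (iota 0 B)) (iota 0 k).
  set t0 := sem (assign 0 (Cst 1)) s.
  have EB0 : cell t0 0 Bvar = B by [].
  rewrite -[sem answer s]/(sem scan t0).
  have := @sem_for I 20 (Loop 21
      (When (Cell bR (index_expr (Var vK) (Var 20) (Var 21)))
        (assign 0 (Cst 0)))) t0 isT (erefl _).
  rewrite EB0; apply=> i t iB Ei fr It.
  pose J k (t' : state) :=
    cell t' 0 0 = (cell t 0 0 == 1) && all (fun y => ~~ P i y) (iota 0 k).
  have EBt : cell t 0 Bvar = B by rewrite fr.
  have := @sem_for J 21
      (When (Cell bR (index_expr (Var vK) (Var 20) (Var 21)))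
        (assign 0 (Cst 0))) t isT.
  rewrite EBt /J => H; rewrite /I cell_put [(0 == 0) && _]/= H.
  + rewrite It eqb1 -[i.+1]addn1 iotaD all_cat /= andbT //.
  + by rewrite /= andbT It eqb1.
  + move=> k t' kB Ek fr' Jt'.
    rewrite -[k.+1]addn1 iotaD all_cat add0n [all _ [:: k]]/= andbT andbA.
    rewrite cell_put [(0 == 0) && _]/= sem_if.
    have -> : holds t' (Cell bR (index_expr (Var vK) (Var 20) (Var 21))) = P i k.
      rewrite /holds /= Ek (fr' 0 20) // Ei (fr' 0 vK) // (fr 0 vK) //.
      rewrite (fr' bT2) // (fr bT2) // (fr' bT1) // (fr bT1) // (fr' bR) // (fr bR) //.
      by rewrite [cell t0 bT2 _]T2 // [cell t0 bT1 _]T1.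
    by case: (P i k); rewrite /= ?andbF ?andbT // Jt'.
split=> [/allP H [x [y R]]|H].
  have xB := rank_lt x; have yB := rank_lt y.
  have := H (rank x); rewrite mem_iota xB => /(_ isT)/allP/(_ (rank y)).
  rewrite mem_iota yB => /(_ isT)/negP; apply; exact: mk.
apply/allP => x; rewrite mem_iota => /= xB; apply/allP => y.
rewrite mem_iota => /= yB; apply/negP => /inv.2[j [x' [y' [E jB R]]]].
have [||Ej _ _] := index_inj xB yB _ _ E; try exact: rank_lt.
by apply: H; exists x', y'; rewrite Ej.
Qed.

End Saturation.

Lemma sem_chain4 c1 c2 c3 c4 s :
  sem (Chain c1 (Chain c2 (Chain c3 c4))) s = sem c4 (sem c3 (sem c2 (sem c1 s))).
Proof. by []. Qed.

Lemma sem_chain6 c1 c2 c3 c4 c5 c6 s :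
  sem (Chain c1 (Chain c2 (Chain c3 (Chain c4 (Chain c5 c6))))) s =
  sem c6 (sem c5 (sem c4 (sem c3 (sem c2 (sem c1 s))))).
Proof. by []. Qed.

Lemma nth_map_rank (A : finType) (f : A -> nat) (a : A) :
  nth 0 [seq f x | x <- enum A] (enum_rank a) = f a.
Proof. by rewrite (nth_map a) ?nth_enum_rank // -cardE ltn_ord. Qed.

Lemma lt_card_rank (A : finType) i : i < #|A| -> exists a : A, i = enum_rank a.
Proof. by move=> iA; exists (enum_val (Ordinal iA)); rewrite enum_valK. Qed.

(** * From the encoded instance to the tables *)

Section Setup.
Variables (X T Sigma : finType) (S : fsa X T Sigma) (Tc : {set T}).
Variables (k1 k2 : nat) (om : bool).
Let S0 := disable S (controllable_trans S Tc).
Let B := fsa_size S + k1 + k2 + 3.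
Let N := if om then #|X|.+1 else 0.

Lemma disable_step l x y : estep S0 l x y <->
  (l = None /\ x = y) \/
  exists t, [/\ (x, t, y) \in trans S, t \notin Tc & label S t = l].
Proof.
have tr t : ((x, t, y) \in trans S0) = ((x, t, y) \in trans S) && (t \notin Tc).
  by rewrite !inE /=; case: (_ \in trans S); rewrite ?andbF ?andbT.
split=> [[?|[t [xty <-]]]|[?|[t [xty nt <-]]]]; [by left| |by left|].
  by right; exists t; move: xty; rewrite tr => /andP[].
by right; exists t; rewrite tr xty nt.
Qed.

Let s1 := sem (header om) (initial_state (encode S Tc k1 k2)).
Let s2 := sem (read_array vN bINI) s1.
Let s3 := sem (read_array vM bLAB) s2.
Let s4 := sem (read_array vM bCTL) s3.
Let s5 := sem read_trans s4.
Let s6 := sem add_stutters s5.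
Let s7 := sem mult_tables s6.

Lemma header_values :
  [/\ cell s1 0 Bvar = B, cell s1 0 vN = #|X|, cell s1 0 vM = #|T|,
      cell s1 0 vQ = #|trans S| & [/\ cell s1 0 vK1 = k1,
      cell s1 0 vKM = k1 + k2 + 1 & cell s1 0 vK = k1 + k2 + 1 + N]].
Proof.
split=> //; last split=> //; rewrite /s1 /=.
- by rewrite /B /fsa_size !addnA.
- by rewrite addnA.
- by rewrite /N; case: om; rewrite /= -?[#|X|.+1]addn1 !addnA.
Qed.

Let F2 b j : ~~ writes (read_array vN bINI) b j -> cell s2 b j = cell s1 b j.
Proof. by move/sem_frame; apply. Qed.
Let F3 b j : ~~ writes (read_array vM bLAB) b j -> cell s3 b j = cell s2 b j.
Proof. by move/sem_frame; apply. Qed.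
Let F4 b j : ~~ writes (read_array vM bCTL) b j -> cell s4 b j = cell s3 b j.
Proof. by move/sem_frame; apply. Qed.
Let F5 b j : ~~ writes read_trans b j -> cell s5 b j = cell s4 b j.
Proof. by move/sem_frame; apply. Qed.
Let F6 b j : ~~ writes add_stutters b j -> cell s6 b j = cell s5 b j.
Proof. by move/sem_frame; apply. Qed.
Let F7 b j : ~~ writes mult_tables b j -> cell s7 b j = cell s6 b j.
Proof. by move/sem_frame; apply. Qed.

Let ini := [seq nat_of_bool (x \in initial S) | x <- enum X].
Let lab := [seq (if label S t is Some a then (enum_rank a).+1 else 0) | t <- enum T].
Let ctl := [seq nat_of_bool (t \in Tc) | t <- enum T].
Let trs := [seq (nat_of_ord (enum_rank e.1.1), nat_of_ord (enum_rank e.1.2),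
                 nat_of_ord (enum_rank e.2)) | e <- enum (trans S)].

Lemma read_values :
  [/\ forall i, cell s7 bINI i = nth 0 ini i, forall i, cell s7 bLAB i = nth 0 lab i,
      forall i, cell s7 bCTL i = nth 0 ctl i &
      forall i, i < #|trans S| ->
      [/\ cell s5 bSRC i = (nth (0, 0, 0) trs i).1.1,
          cell s5 bEV i = (nth (0, 0, 0) trs i).1.2
        & cell s5 bDST i = (nth (0, 0, 0) trs i).2]].
Proof.
have [EB En Em Eq _] := header_values.
have zi : size ini = #|X| by rewrite size_map -cardE.
have zl : size lab = #|T| by rewrite size_map -cardE.
have zc : size ctl = #|T| by rewrite size_map -cardE.
have zt : size trs = #|trans S| by rewrite size_map -cardE.
have nB : #|X| <= B by rewrite /B /fsa_size; lia.
have mB : #|T| <= B by rewrite /B /fsa_size; lia.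
have qB : #|trans S| <= B by rewrite /B /fsa_size; lia.
have R1 : rest s1 = ini ++ (lab ++ (ctl ++
    flatten [seq [:: a.1.1; a.1.2; a.2] | a <- trs])).
  by rewrite /trs -map_comp.
have [|||R2 E2] := @read_arrayE vN bINI s1 ini _ isT isT R1; rewrite ?En ?EB ?zi //.
rewrite -/s2 in R2 E2.
have [|||R3 E3] := @read_arrayE vM bLAB s2 lab _ isT isT R2; rewrite ?zl.
- by rewrite F2.
- by rewrite F2 // EB.
- by move=> i; rewrite F2.
rewrite -/s3 in R3 E3.
have [|||R4 E4] := @read_arrayE vM bCTL s3 ctl _ isT isT R3; rewrite ?zc.
- by rewrite F3 // F2.
- by rewrite F3 // F2 // EB.
- by move=> i; rewrite F3 // F2.
rewrite -/s4 in R4 E4.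
have szt : size trs = cell s4 0 vQ by rewrite zt F4 // F3 // F2.
have ltB : size trs <= cell s4 0 Bvar by rewrite zt F4 // F3 // F2 // EB.
have H := @read_transE s4 trs R4 szt ltB.
split=> [i|i|i|i iq]; last by apply: H; rewrite zt.
- by rewrite F7 // F6 // F5 // F4 // F3 // E2.
- by rewrite F7 // F6 // F5 // F4 // E3.
- by rewrite F7 // F6 // F5 // E4.
Qed.

Lemma setup_static : Static S0 k1 k2 B (static_part s7).
Proof.
have [EB En Em Eq [Ek1 EKM _]] := header_values.
have [Ei El Ec Et] := read_values.
have zl : size lab = #|T| by rewrite size_map -cardE.
have zc : size ctl = #|T| by rewrite size_map -cardE.
have small v : v < 20 -> (v == 20) = false by lia.
have E5 v : v < 20 -> cell s5 0 v = cell s1 0 v.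
  by move/small=> v20; rewrite F5 ?F4 ?F3 ?F2 //= ?v20.
have E6 v : v < 20 -> cell s6 0 v = cell s1 0 v.
  by move=> v20; rewrite F6 ?E5 //= small.
have E7 v : v < 10 -> cell s7 0 v = cell s1 0 v.
  by move=> v10; rewrite F7 ?E6 //= /may_touch; lia.
have [|St1 St2] := @add_stuttersE s5.
  by rewrite !E5 // En EB /B /fsa_size; lia.
rewrite -/s6 in St1 St2.
have Tb : forall i, i < B -> cell s7 bT1 i = i * B /\ cell s7 bT2 i = i * (B * B).
  by have := @mult_tablesE s6; rewrite !E6 // EB; apply.
have Q i x y z : i < #|trans S| -> nth (0, 0, 0) trs i = (x, y, z) ->
    [/\ cell s7 bSRC i = x, cell s7 bEV i = y & cell s7 bDST i = z].
  move=> iq E; have := Et i iq; rewrite E => -[E1 E2 E3].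
  rewrite !F7 // -[x]E1 -[y]E2 -[z]E3.
  by apply: St1; rewrite E5 // Eq.
have Z i : i < #|X| -> [/\ cell s7 bSRC (#|trans S| + i) = i,
     cell s7 bEV (#|trans S| + i) = #|T| & cell s7 bDST (#|trans S| + i) = i].
  move=> iX; rewrite !F7 //; have := St2 i; rewrite !E5 // Em Eq En.
  exact.
have nthtr e : e \in trans S -> exists2 i, i < #|trans S| & nth (0, 0, 0) trs i =
    (nat_of_ord (enum_rank e.1.1), nat_of_ord (enum_rank e.1.2), nat_of_ord (enum_rank e.2)).
  move=> eS; have ie : index e (enum (trans S)) < #|trans S|.
    by rewrite cardE index_mem mem_enum.
  by exists (index e (enum (trans S))) => //; rewrite (nth_map e) -?cardE // nth_index ?mem_enum.
split.
- by rewrite [LHS]E7.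
- by rewrite [static_part s7 0 vN]E7 // [static_part s7 0 vQ]E7 // En Eq /B /fsa_size; lia.
- by rewrite [LHS]E7.
- by rewrite [LHS]E7.
- by move=> i /Tb[].
- by move=> i /Tb[].
- move=> i; rewrite [static_part _ _ _]Ei => pos.
  have iX : i < #|X|.
    by rewrite ltnNge; apply: contraL pos => le; rewrite nth_default // size_map -cardE.
  have [x E] := lt_card_rank iX; exists x => //; move: pos.
  by rewrite E nth_map_rank; case: (x \in _).
- by move=> x ix; rewrite [static_part _ _ _]Ei nth_map_rank ix.
- move=> e; rewrite [static_part s7 0 vN]E7 // [static_part s7 0 vQ]E7 // En Eq.
  rewrite [static_part s7 bCTL _]Ec [static_part s7 bLAB _]El => eb.
  case: (ltnP e #|trans S|) => eq cz.
    have [e0 _] : exists e0 : X * T * X, True.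
      by case: (pickP (mem (trans S))) => [a _|/eq_card0 E]; [exists a|rewrite E in eq].
    pose a := nth e0 (enum (trans S)) e.
    have aS : a \in trans S by rewrite -mem_enum mem_nth // -cardE.
    have Ea : nth (0, 0, 0) trs e = (nat_of_ord (enum_rank a.1.1),
        nat_of_ord (enum_rank a.1.2), nat_of_ord (enum_rank a.2)).
      by rewrite (nth_map e0) // -cardE.
    have [S1 S2 S3] := Q _ _ _ _ eq Ea.
    exists (label S a.1.2), a.1.1, a.2; split=> //.
    + apply/disable_step; right; exists a.1.2; split=> //; first by case: (a) aS => [[]].
      by move: cz; rewrite [static_part s7 bEV e]S2 nth_map_rank; case: (_ \in _).
    + by rewrite [static_part s7 bEV e]S2 nth_map_rank.
  (* Entries from |trans S| on are the stutters. *)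
  have iX : e - #|trans S| < #|X| by lia.
  have [S1 S2 S3] := Z _ iX; rewrite subnKC // in S1 S2 S3.
  have [x Ex] := lt_card_rank iX.
  exists None, x, x; split; rewrite -?Ex //; first by apply/disable_step; left.
  (* Event number |T| lies past the end of the label table, and the default 0 is the code of
     epsilon. *)
  by rewrite [static_part s7 bEV e]S2 nth_default // size_map -cardE.
- move=> l x y /disable_step[[-> <-]|[t [xty nt <-]]].
    have [S1 S2 S3] := Z _ (ltn_ord (enum_rank x)).
    exists (#|trans S| + enum_rank x).
    rewrite [static_part s7 0 vN]E7 // [static_part s7 0 vQ]E7 // En Eq.
    rewrite addnC ltn_add2r ltn_ord addnC.
    rewrite [static_part s7 bEV _]S2 [static_part s7 bCTL _]Ec [static_part s7 bLAB _]El.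
    rewrite [static_part s7 bSRC _]S1 [static_part s7 bDST _]S3.
    by rewrite !nth_default ?zl ?zc //; split.
  have [i iq Ei'] := nthtr _ xty; have [S1 S2 S3] := Q _ _ _ _ iq Ei'.
  exists i; rewrite [static_part s7 0 vN]E7 // [static_part s7 0 vQ]E7 // En Eq.
  rewrite [static_part s7 bEV _]S2 [static_part s7 bCTL _]Ec [static_part s7 bLAB _]El.
  rewrite [static_part s7 bSRC _]S1 [static_part s7 bDST _]S3 !nth_map_rank (negbTE nt).
  by split=> //; apply: leq_trans iq (leq_addl _ _).
Qed.

Lemma main_cmdE : exists b : bool, cell (sem main_cmd s1) 0 0 = b /\
  (b <-> ~ ambiguous S0 k1 k2 N).
Proof.
have [EB En Em Eq [_ _ EK]] := header_values.
have XB : #|X| <= B by rewrite /B /fsa_size; lia.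
have inv7 : Inv S0 k1 k2 B (static_part s7) s7.
  by split=> // a; rewrite /marked F7 // F6 // F5 // F4 // F3 // F2.
have [inv8 im] := mark_initialE XB setup_static inv7.
have [inv9 mk] := saturateE XB setup_static inv8 im.
have EK9 : static_part (sem saturate (sem mark_initial s7)) 0 vK = k1 + k2 + 1 + N.
  by case: inv9 => -> _; rewrite [LHS]F7 // F6 // F5 // F4 // F3 // F2.
have KB : k1 + k2 + 1 + N < B by rewrite /N /B /fsa_size; case: om; lia.
have [|b [Eb Hb]] := answerE XB setup_static inv9 _ mk; first by rewrite EK9.
exists b; split.
  rewrite [sem main_cmd s1](sem_chain4 setup mark_initial saturate answer s1).
  rewrite [sem setup s1](sem_chain6 (read_array vN bINI) (read_array vM bLAB)
    (read_array vM bCTL) read_trans add_stutters mult_tables s1).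
  exact: Eb.
rewrite Hb EK9.
split=> nex; [move=> /ambiguous_reach|move=> [x [y /reach_ambiguous]]] => //.
Qed.

End Setup.

(** The two notions of detectability differ only in [N], so a flag selects the program. The header
    takes constant time, and the loop bound is the input measure plus 3, whence the composition with
    ['X + 3%:P]. *)
Lemma decision_procedure (om : bool) : exists (P : program) (p : {poly nat}),
  forall (X T Sigma : finType) (S : fsa X T Sigma) (Tc : {set T}) (k1 k2 : nat),
  exists b : bool,
    (b <-> exists D : {set X * T * X}, D \subset controllable_trans S Tc /\
       ~ ambiguous (disable S D) k1 k2 (if om then #|X|.+1 else 0)) /\
    outputs_within P (encode S Tc k1 k2) (p.[(fsa_size S + k1 + k2)%N])%R b.
Proof.
have [p Ep] := time_poly main_cmd.
exists (two_stage (header om) main_cmd),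
  ((time 0 (header om))%:P + (p \Po ('X + 3%:P)))%R.
move=> X T Sigma S Tc k1 k2; have [b [Eb Hb]] := main_cmdE S Tc k1 k2 om.
exists b; split.
  by rewrite Hb; split=> [?|]; [apply/exists_disable|move/exists_disable].
have [EB _ _ _ _] := header_values S Tc k1 k2 om.
have := @two_stageE (header om) main_cmd (encode S Tc k1 k2) _ isT isT _ _ (erefl _).
rewrite Eb EB Ep hornerD hornerC horner_comp hornerD hornerX hornerC.
by apply; case: (om).
Qed.

Theorem mainTheorem9 :
  (exists (P : program) (p : {poly nat}),
     forall (X T Sigma : finType) (S : fsa X T Sigma) (Tc : {set T})
       (k1 k2 : nat),
     ~ omega_detectable S k1 k2 ->
     exists b : bool,
       (b <-> exists D : {set X * T * X},
                D \subset controllable_trans S Tc /\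
                omega_detectable (disable S D) k1 k2) /\
       outputs_within P (encode S Tc k1 k2)
         (p.[(fsa_size S + k1 + k2)%N])%R b)
  /\
  (exists (P : program) (p : {poly nat}),
     forall (X T Sigma : finType) (S : fsa X T Sigma) (Tc : {set T})
       (k1 k2 : nat),
     ~ star_detectable S k1 k2 ->
     exists b : bool,
       (b <-> exists D : {set X * T * X},
                D \subset controllable_trans S Tc /\
                star_detectable (disable S D) k1 k2) /\
       outputs_within P (encode S Tc k1 k2)
         (p.[(fsa_size S + k1 + k2)%N])%R b).
Proof.
split.
  have [P [p H]] := decision_procedure true; exists P, p.
  move=> X T Sigma S Tc k1 k2 _; have [b [Hb out]] := H X T Sigma S Tc k1 k2.
  exists b; split=> //; rewrite Hb.
  by split=> -[D [sD d]]; exists D; split=> //; apply/omega_detectableP.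
have [P [p H]] := decision_procedure false; exists P, p.
move=> X T Sigma S Tc k1 k2 _; have [b [Hb out]] := H X T Sigma S Tc k1 k2.
exists b; split=> //; rewrite Hb.
by split=> -[D [sD d]]; exists D; split=> //; apply/star_detectableP.
Qed.
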